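(* Let $f:\mathbb{R}^d\to\mathbb{R}$ be differentiable with $f_\star:=\inf_{\boldsymbol{x}\in\mathbb{R}^d}f(\boldsymbol{x})>-\infty$, and suppose there is $\boldsymbol{L}\in\mathbb{R}_{>0}^d$ such that $|f(\boldsymbol{x})-f(\boldsymbol{y})-\langle\nabla f(\boldsymbol{y}),\boldsymbol{x}-\boldsymbol{y}\rangle|\le\frac12\|\boldsymbol{x}-\boldsymbol{y}\|_{\boldsymbol{L}}^2$ for all $\boldsymbol{x},\boldsymbol{y}\in\mathbb{R}^d$. Suppose the stochastic gradients $\boldsymbol{g}_t$ satisfy $\mathbb{E}_{t-1}[\boldsymbol{g}_t]=\nabla f(\boldsymbol{x}_t)$ and, for some $p\in(1,2]$ and $\boldsymbol{\sigma}\in\mathbb{R}_{\ge0}^d$, $\mathbb{E}_{t-1}[|\boldsymbol{\xi}_{t,i}|^p]\le\boldsymbol{\sigma}_i^p$ for all $i\in\{1,\dots,d\}$ and all $t$, where $\boldsymbol{\xi}_{t,i}:=\boldsymbol{g}_{t,i}-\nabla_i f(\boldsymbol{x}_t)$. Let $\Delta:=f(\boldsymbol{x}_1)-f_\star$. Then for any $\gamma>0$, $\lambda>0$ and $T\in\mathbb{N}$, the iterates of AdaGrad-Norm satisfy $$\mathbb{E}\left[\frac1T\sum_{t=1}^T\|\nabla f(\boldsymbol{x}_t)\|_2\right]\le\mathcal{O}\left(\frac{\lambda+\frac{\Delta}{\gamma}+\gamma\|\boldsymbol{L}\|_\infty\ln K_T}{\sqrt T}+\frac{\|\boldsymbol{\sigma}\|_p(\ln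 K_T)^{\frac1{\bar p}+\frac12}}{T^{\frac{p-1}{p}}}+\frac{\sqrt{\left(\frac{\Delta}{\gamma}+\gamma\|\boldsymbol{L}\|_\infty\ln K_T\right)\|\boldsymbol{\sigma}\|_p}}{T^{\frac{p-1}{2p}}}+\frac{\|\boldsymbol{\sigma}\|_p(\ln K_T)^{\frac1{2\bar p}+\frac14}}{T^{\frac{3p-4}{4p}}}\right),$$ where $$K_T:=1+\frac{\sqrt2\|\boldsymbol{\sigma}\|_pT^{\frac1p}+2\|\nabla f(\boldsymbol{x}_1)\|_2T^{\frac12}+2\gamma\|\boldsymbol{L}\|_\infty T^{\frac32}}{\lambda}.$$
   Context: $\mathbb{N}$ excludes $0$. For $p>1$, $\bar p:=p/(p-1)$. For $\boldsymbol{L}\in\mathbb{R}_{>0}^d$, $\|\boldsymbol{x}\|_{\boldsymbol{L}}^2:=\sum_{i=1}^d\boldsymbol{L}_i\boldsymbol{x}_i^2$. $\nabla_i f$ is the $i$-th partial derivative. $\mathcal{O}(\cdot)$ hides a universal numerical constant. AdaGrad-Norm: given a (deterministic) initial point $\boldsymbol{x}_1\in\mathbb{R}^d$, learning rate $\gamma>0$ and hyperparameter $\lambda>0$, set $v_0=0$ and for $t=1,2,\dots$ query a random stochastic gradient $\boldsymbol{g}_t\in\mathbb{R}^d$ at $\boldsymbol{x}_t$ and set $v_t=v_{t-1}+\|\boldsymbol{g}_t\|_2^2$ and $\boldsymbol{x}_{t+1}=\boldsymbol{x}_t-\frac{\gamma}{\lambda+\sqrt{v_t}}\boldsymbol{g}_t$.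 $\mathcal{F}_t:=\sigma(\boldsymbol{g}_1,\dots,\boldsymbol{g}_t)$ is the natural filtration ($\mathcal{F}_0$ trivial) and $\mathbb{E}_t[\cdot]:=\mathbb{E}[\cdot\mid\mathcal{F}_t]$. *)

(* Defs.v *)
From HB Require Import structures.
From mathcomp Require Import all_boot all_order all_algebra.
From mathcomp Require Import all_classical all_reals all_analysis.
Set Implicit Arguments.
Unset Strict Implicit.
Unset Printing Implicit Defensive.
Import Order.TTheory GRing.Theory Num.Theory.
Import numFieldNormedType.Exports.
Local Open Scope classical_set_scope.
Local Open Scope ring_scope.

Section vectors.
Context {R : realType} {d : nat}.
Implicit Types (x y L : 'rV[R]_d) (f : 'rV[R]_d -> R).

Definition dot x y : R := \sum_i x 0 i * y 0 i.

Definition l2norm x : R := Num.sqrt (\sum_i x 0 i ^+ 2).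

Definition lpnorm (p : R) x : R := (\sum_i `|x 0 i| `^ p) `^ p^-1.

(* The normed-module structure of row vectors is that of the max norm. *)
Definition linfnorm x : R := `|x|.

Definition weighted_norm2 L x : R := \sum_i L 0 i * x 0 i ^+ 2.

Definition partial_deriv f (i : 'I_d) x : R := 'D_(delta_mx 0 i) f x.

Definition gradient f x : 'rV[R]_d := \row_i partial_deriv f i x.

End vectors.

Section conditional_expectation.
Local Open Scope ereal_scope.
Context {disp : measure_display} {Omega : measurableType disp} {R : realType}.
Variable P : probability Omega R.

(* [Y] is a version of the conditional expectation of [X] given the
   sigma-algebra [F]. *)
Definition is_cond_expectation (F : set (set Omega)) (X Y : Omega -> R) : Prop :=
  [/\ P.-integrable setT (EFin \o X),
      P.-integrable setT (EFin \o Y),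
      (forall B : set R, measurable B -> F (Y @^-1` B))
    & (forall A, F A -> \int[P]_(w in A) (Y w)%:E = \int[P]_(w in A) (X w)%:E)].

(* E[X | F] <= c almost surely; versions of E[X | F] are almost surely equal,
   so the choice of version is immaterial. *)
Definition cond_expectation_le (F : set (set Omega)) (X : Omega -> R) (c : R)
    : Prop :=
  exists Y : Omega -> R,
    is_cond_expectation F X Y /\ {ae P, forall w, (Y w <= c)%R}.

End conditional_expectation.

Section processes.
Context {disp : measure_display} {Omega : measurableType disp}.
Context {R : realType} {d : nat}.

Definition random_vector (X : Omega -> 'rV[R]_d) : Prop :=
  forall i, measurable_fun setT (fun w => X w 0 i).

(* sigma(g_1, ..., g_t): the Borel sigma-algebra of R^d is generated by the
   coordinates. For t = 0 the generating family is empty, so this is the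
   trivial sigma-algebra; g_0 is never used. *)
Definition natural_filtration (g : nat -> Omega -> 'rV[R]_d) (t : nat)
    : set (set Omega) :=
  <<s \bigcup_(s in [set s | (1 <= s <= t)%N])
        \bigcup_(i in [set: 'I_d])
          preimage_set_system setT (fun w => g s w 0 i)
            (measurable : set (set R)) >>.

(* The iterates are x_1, x_2, ...; x_0 and g_0 are unconstrained. *)
Definition adagrad_norm (gamma lambda : R) (x1 : 'rV[R]_d)
    (g : nat -> Omega -> 'rV[R]_d)
    (v : nat -> Omega -> R) (x : nat -> Omega -> 'rV[R]_d) : Prop :=
  forall w,
    [/\ v 0%N w = 0,
        x 1%N w = x1
      & forall t, (1 <= t)%N ->
          v t w = v t.-1 w + l2norm (g t w) ^+ 2 /\
          x t.+1 w = x t w - (gamma / (lambda + Num.sqrt (v t w))) *: g t w].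

End processes.

(* Main.v *)
Require Import Defs.
From HB Require Import structures.
From mathcomp Require Import all_boot all_order all_algebra.
From mathcomp Require Import all_classical all_reals all_analysis.
From mathcomp Require Import measurable_realfun ring lra.
Set Implicit Arguments.
Unset Strict Implicit.
Unset Printing Implicit Defensive.
Import Order.TTheory GRing.Theory Num.Theory.
Import numFieldNormedType.Exports.
Local Open Scope classical_set_scope.
Local Open Scope ring_scope.

(** Write n_t for the Euclidean norm of the gradient at x_t, xi_t for the noise,
    b_t = lambda + sqrt v_t for the random denominator, q_t = (|g_t| / b_t)^2
    and l = ln K.  The descent inequality bounds the sum of <grad_t, g_t> / b_t
    by Delta / gamma plus gamma |L| / 2 times the sum of the q_t, and this last
    sum telescopes to a logarithm of b_T ([sqr_ratio_sum_le]).  The tangent of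
    ln at K replaces Jensen's inequality: ln (b_T / lambda) is at most
    l + b_T / (lambda K) - 1, whose expectation is O(l) when K > 4.

    The difficulty is that b_t depends on g_t.  It is replaced by the
    denominator beta_t = lambda + sqrt (v_{t-1} + (n_t + tau)^2), which depends
    on the past only.  As |b_t - beta_t| <= |xi_t| + tau, the replacement costs
    (n_t / beta_t) sqrt q_t (|xi_t| + tau) ([descent_proxy]).  Only the p-th
    moment of xi_t is available, so this error is truncated at a level M
    ([cross_term_le]): below M, |xi|^2 <= |xi|^p M^(2-p), and the error is
    absorbed by n_t^2 / beta_t and tau q_t; above M, |xi| <= |xi|^p M^(1-p).
    Let s be the l^p norm of sigma.  With M = s (T / l)^(1/p) and
    tau = M sqrt (l / T), the effective size of the noise, both parts are
    balanced, and the energy, the sum of E [n_t^2 / beta_t], is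
    O (Delta / gamma + gamma |L| l + tau l) ([expected_energy_sum]).
    The conditional hypotheses enter only through products of the noise with
    bounded random variables of the past; these are handled by approximating
    such a variable uniformly by a staircase ([Rintegral_bounded_mul_eq0]).

    Finally G^2, the sum of the n_t^2, is at most the sum of the n_t^2 / beta_t
    times lambda + tau + sqrt v_T + G, and sqrt v_T is controlled by G and by the
    total noise, whose expectation is O (s T^(1/p)) because the l^2 norm is at
    most the l^p norm.  The inequality between arithmetic and geometric means
    with a deterministic weight kappa makes this bound linear, hence
    integrable term by term ([sum_sqr_grad_norm_le]); the best kappa produces
    the two square-root terms of the rate ([balance_kappa]).  If K <= 4, the
    pathwise bound on the gradients ([grad_norm_le]) is already
    O (lambda / sqrt T). *)

(** * Euclidean norms and powers *)

Section euclidean.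
Context {R : realType} {d : nat}.
Implicit Types (x y L : 'rV[R]_d).

Lemma l2norm_ge0 x : 0 <= l2norm x.
Proof. exact: sqrtr_ge0. Qed.

Lemma l2norm_sqr x : l2norm x ^+ 2 = \sum_i x 0 i ^+ 2.
Proof. by rewrite sqr_sqrtr// sumr_ge0// => i _; exact: sqr_ge0. Qed.

Lemma dotxx x : dot x x = l2norm x ^+ 2.
Proof. by rewrite l2norm_sqr; apply: eq_bigr => i _; rewrite expr2. Qed.

Lemma dotDr x y z : dot x (y + z) = dot x y + dot x z.
Proof. by rewrite -big_split; apply: eq_bigr => i _ /=; rewrite mxE mulrDr. Qed.

Lemma dotBl x y z : dot (x - y) z = dot x z - dot y z.
Proof. by rewrite -sumrB; apply: eq_bigr => i _ /=; rewrite !mxE mulrBl. Qed.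

Lemma dotZr a x y : dot x (a *: y) = a * dot x y.
Proof. by rewrite mulr_sumr; apply: eq_bigr => i _ /=; rewrite mxE mulrCA. Qed.

Lemma l2normZ a x : l2norm (a *: x) = `|a| * l2norm x.
Proof.
rewrite /l2norm; under eq_bigr do rewrite mxE exprMn.
by rewrite -mulr_sumr sqrtrM ?sqr_ge0// sqrtr_sqr.
Qed.

Lemma l2normN x : l2norm (- x) = l2norm x.
Proof. by rewrite -scaleN1r l2normZ normrN1 mul1r. Qed.

(** The sum of the squares of |y|^2 x_i - <x, y> y_i is nonnegative. *)
Lemma cauchy_schwarz x y : `|dot x y| <= l2norm x * l2norm y.
Proof.
rewrite -(@ler_pXn2r _ 2)// ?nnegrE ?mulr_ge0 ?l2norm_ge0// exprMn real_normK ?num_real//.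
have [y0|y0] := eqVneq (l2norm y ^+ 2) 0.
  rewrite y0 mulr0 /dot big1 ?expr0n// => i _.
  move: y0; rewrite l2norm_sqr => /eqP; rewrite psumr_eq0; last by move=> j _; exact: sqr_ge0.
  by move=> /allP/(_ i (mem_index_enum _)) /=; rewrite sqrf_eq0 => /eqP ->; rewrite mulr0.
set A := l2norm x ^+ 2; set B := l2norm y ^+ 2; set D := dot x y.
have B0 : 0 < B by rewrite lt_def y0 sqr_ge0.
have : 0 <= \sum_i (B * x 0 i - D * y 0 i) ^+ 2.
  by rewrite sumr_ge0// => i _; exact: sqr_ge0.
have expand b c : \sum_i (b * x 0 i - c * y 0 i) ^+ 2 =
    b ^+ 2 * \sum_i x 0 i ^+ 2 - 2 * b * c * \sum_i x 0 i * y 0 i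
    + c ^+ 2 * \sum_i y 0 i ^+ 2.
  by rewrite !mulr_sumr -sumrB -big_split; apply: eq_bigr => i _ /=; ring.
rewrite expand -!l2norm_sqr -/A -/B -/(dot x y) -/D.
have -> : B ^+ 2 * A - 2 * B * D * D + D ^+ 2 * B = B * (A * B - D ^+ 2) by ring.
by rewrite pmulr_rge0// subr_ge0.
Qed.

Lemma l2norm_triangle x y : l2norm (x + y) <= l2norm x + l2norm y.
Proof.
rewrite -(@ler_pXn2r _ 2)// ?nnegrE ?addr_ge0 ?l2norm_ge0//.
have -> : l2norm (x + y) ^+ 2 = l2norm x ^+ 2 + l2norm y ^+ 2 + 2 * dot x y.
  rewrite !l2norm_sqr /dot mulr_sumr -!big_split; apply: eq_bigr => i _ /=.
  by rewrite mxE; ring.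
have := le_trans (ler_norm _) (cauchy_schwarz x y); lra.
Qed.

Lemma l2norm_lipschitz x y : `|l2norm x - l2norm y| <= l2norm (x - y).
Proof.
rewrite ler_norml; apply/andP; split.
  by have := l2norm_triangle (y - x) x; rewrite subrK -(opprB x y) l2normN; lra.
by have := l2norm_triangle (x - y) y; rewrite subrK; lra.
Qed.

Lemma coord_le_l2norm x i : `|x 0 i| <= l2norm x.
Proof.
rewrite -sqrtr_sqr ler_sqrt ?sumr_ge0// => [|j _]; last exact: sqr_ge0.
by rewrite (bigD1 i)//= lerDl sumr_ge0// => j _; exact: sqr_ge0.
Qed.

Lemma coord_le_linfnorm x i : `|x 0 i| <= linfnorm x.
Proof.
rewrite /linfnorm [leRHS]/Num.Def.normr /= mx_normrE.
exact: (@le_bigmax _ _ _ 0 (fun ij : 'I_1 * 'I_d => `|x ij.1 ij.2|) (0, i)).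
Qed.

Lemma linfnorm_ge0 L : 0 <= linfnorm L.
Proof. exact: normr_ge0. Qed.

Lemma weighted_norm2_le L x : weighted_norm2 L x <= linfnorm L * l2norm x ^+ 2.
Proof.
rewrite l2norm_sqr mulr_sumr; apply: ler_sum => i _.
by rewrite ler_wpM2r ?sqr_ge0// (le_trans (ler_norm _))// coord_le_linfnorm.
Qed.

End euclidean.

Section lp.
Context {R : realType}.

Lemma sqr_powR (u p : R) : 0 <= u -> u ^+ 2 = u `^ p * u `^ (2 - p).
Proof.
move=> u0; rewrite -powRD.
  by rewrite addrC subrK powR_mulrn.
by rewrite addrC subrK pnatr_eq0.
Qed.

(** The l^2 norm is at most the l^p norm: with Z the l^2 norm, each u_i <= Z, so
    u_i^2 <= u_i^p Z^(2-p). *)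
Lemma powR_sqrt_sum_le (I : eqType) (s : seq I) (u : I -> R) (p : R) :
  0 < p <= 2 -> (forall i, 0 <= u i) ->
  Num.sqrt (\sum_(i <- s) u i ^+ 2) `^ p <= \sum_(i <- s) u i `^ p.
Proof.
move=> /andP[p0 p2] u0.
have S0 : 0 <= \sum_(i <- s) u i ^+ 2 by rewrite sumr_ge0// => i _; exact: sqr_ge0.
have := sqrtr_ge0 (\sum_(i <- s) u i ^+ 2).
rewrite le_eqVlt => /orP[/eqP <-|Z0].
  by rewrite powR0 ?gt_eqF// sumr_ge0// => i _; exact: powR_ge0.
set Z := Num.sqrt _ in Z0 *.
have : Z `^ p * Z `^ (2 - p) <= (\sum_(i <- s) u i `^ p) * Z `^ (2 - p).
  rewrite -(sqr_powR p (ltW Z0)) sqr_sqrtr// mulr_suml.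
  rewrite big_seq [leRHS]big_seq; apply: ler_sum => i si.
  rewrite (sqr_powR p)// ler_wpM2l ?powR_ge0//.
  apply: ge0_ler_powR; rewrite ?subr_ge0 ?nnegrE ?(ltW Z0)//.
  rewrite -[u i]ger0_norm// -sqrtr_sqr ler_sqrt// (big_rem i)//= lerDl.
  by rewrite sumr_ge0// => j _; exact: sqr_ge0.
by rewrite ler_pM2r// powR_gt0.
Qed.

(** Large values of z are paid with their p-th power. *)
Lemma le_powR_trunc (m z p : R) : 0 < m -> m <= z -> 1 <= p -> z <= z `^ p * m `^ (1 - p).
Proof.
move=> m0 mz p1.
have z0 : 0 < z by exact: lt_le_trans mz.
rewrite -(mulr_powRB1 (ltW z0)) ?(lt_le_trans ltr01)// -mulrA.
rewrite ler_peMr ?(ltW z0)// -(opprB p 1) powRN.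
rewrite ler_pdivlMr ?powR_gt0// mul1r.
by apply: ge0_ler_powR; rewrite ?subr_ge0// nnegrE ltW.
Qed.

(** Linear in z^p, hence it bounds an expectation by a p-th moment without
    Jensen's inequality; optimal for m close to the p-th root of the moment. *)
Lemma le_add_powR_trunc (m z p : R) : 0 < m -> 0 <= z -> 1 <= p ->
  z <= m + z `^ p * m `^ (1 - p).
Proof.
move=> m0 z0 p1; have [zm|mz] := leP z m.
  by rewrite (le_trans zm)// lerDl mulr_ge0// powR_ge0.
by rewrite (le_trans (le_powR_trunc m0 (ltW mz) p1))// lerDr ltW.
Qed.

End lp.

(** * Scalar inequalities behind one step *)

Section scalar.
Context {R : realType}.
Implicit Types (v a b n N z tau lam : R).

Lemma sqrt_add_sqr_lipschitz v a b : 0 <= v ->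
  `|Num.sqrt (v + a ^+ 2) - Num.sqrt (v + b ^+ 2)| <= `|a - b|.
Proof.
move=> v0.
have half c e : Num.sqrt (v + c ^+ 2) <= Num.sqrt (v + e ^+ 2) + `|c - e|.
  rewrite -(@ler_pXn2r _ 2)// ?nnegrE ?addr_ge0 ?sqrtr_ge0//.
  rewrite sqrrD !sqr_sqrtr ?addr_ge0 ?sqr_ge0// real_normK ?num_real//.
  have : `|e| <= Num.sqrt (v + e ^+ 2).
    by rewrite -sqrtr_sqr ler_sqrt ?addr_ge0 ?sqr_ge0// lerDr.
  have : e * (c - e) <= `|e| * `|c - e| by rewrite -normrM ler_norm.
  move: (Num.sqrt _) => s h1 h2.
  have := ler_wpM2r (normr_ge0 (c - e)) h2.
  rewrite mulr2n; nra.
rewrite ler_norml; apply/andP; split.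
  by have := half b a; rewrite distrC; lra.
by have := half a b; lra.
Qed.

(** The true denominator b contains the current stochastic gradient of norm N;
    beta contains n + tau instead.  The map c |-> sqrt (v + c^2) is
    1-Lipschitz, so b and beta differ by at most z + tau. *)
Lemma descent_proxy lam v n N z tau c b beta :
  b = lam + Num.sqrt (v + N ^+ 2) ->
  beta = lam + Num.sqrt (v + (n + tau) ^+ 2) ->
  0 < lam -> 0 <= v -> 0 <= n -> 0 <= N -> 0 <= tau ->
  `|N - n| <= z -> `|c| <= n * N ->
  c / beta - (n / beta) * (N / b) * (z + tau) <= c / b.
Proof.
move=> bE betaE l0 v0 n0 N0 t0 Nn cnN.
have b0 : 0 < b by rewrite bE ltr_pwDl// sqrtr_ge0.
have beta0 : 0 < beta by rewrite betaE ltr_pwDl// sqrtr_ge0.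
have gap : `|b - beta| <= z + tau.
  have -> : b - beta = Num.sqrt (v + N ^+ 2) - Num.sqrt (v + (n + tau) ^+ 2).
    by rewrite bE betaE; ring.
  rewrite (le_trans (sqrt_add_sqr_lipschitz _ _ v0))//.
  by rewrite opprD addrA (le_trans (ler_normB _ _))// (ger0_norm t0) lerD2r.
rewrite lerBlDl -lerBlDr.
have -> : c / beta - c / b = c * (b - beta) / (beta * b).
  by field; rewrite !gt_eqF.
have -> : n / beta * (N / b) * (z + tau) = n * N * (z + tau) / (beta * b).
  by field; rewrite !gt_eqF.
rewrite ler_pM2r ?invr_gt0 ?mulr_gt0//.
by rewrite (le_trans (ler_norm _))// normrM ler_pM.
Qed.

(** With a = lam + sqrt v, the left side is (b - a)(b + a - 2 lam) / b^2, at most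
    2 (1 - a / b), and 1 - a / b <= - ln (a / b). *)
Lemma sqr_ratio_le_ln lam v N b : b = lam + Num.sqrt (v + N ^+ 2) ->
  0 < lam -> 0 <= v ->
  (N / b) ^+ 2 <= 2 * (ln b - ln (lam + Num.sqrt v)).
Proof.
move=> bE l0 v0.
have vN0 : 0 <= v + N ^+ 2 by rewrite addr_ge0 ?sqr_ge0.
have b0 : 0 < b by rewrite bE ltr_pwDl// sqrtr_ge0.
set a := lam + _; have a0 : 0 < a by rewrite ltr_pwDl// sqrtr_ge0.
have lnab : ln (a / b) <= a / b - 1.
  by rewrite -{1}[a / b](subrKC 1) le_ln1Dx// ltrBrDl subrr divr_gt0.
rewrite ln_div ?posrE// in lnab.
suff : (N / b) ^+ 2 <= 2 * (1 - a / b) by lra.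
rewrite expr_div_n ler_pdivrMr ?exprn_gt0//.
have -> : 2 * (1 - a / b) * b ^+ 2 = 2 * (b - a) * b by field; rewrite gt_eqF.
have sab : Num.sqrt v <= Num.sqrt (v + N ^+ 2) by rewrite ler_sqrt// lerDl sqr_ge0.
have <- : Num.sqrt (v + N ^+ 2) ^+ 2 - Num.sqrt v ^+ 2 = N ^+ 2.
  by rewrite !sqr_sqrtr//; ring.
have := sqrtr_ge0 v.
by rewrite bE /a; move: (Num.sqrt v) (Num.sqrt (v + _)) sab => s r sr s0; nra.
Qed.

(** Here a = n_t / beta_t, c = |g_t| / b_t and W bounds the p-th power of the
    noise z.  If z <= M, Young's inequality leaves a^2 z^2 / tau with
    z^2 <= W M^(2-p); if z > M, use c <= 1 and z <= W M^(1-p).  The right side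
    is linear in W, so that a conditional expectation can be taken. *)
Lemma cross_term_le a c z W tau M p :
  0 <= a -> 0 <= c <= 1 -> 0 <= z -> z `^ p <= W -> 0 < tau -> 0 < M -> 1 < p <= 2 ->
  a * c * (z + tau) <= a ^+ 2 * tau / 8 + 4 * tau * c ^+ 2
     + a ^+ 2 * W * M `^ (2 - p) / (8 * tau) + a * W * M `^ (1 - p).
Proof.
move=> a0 /andP[c0 c1] z0 zW t0 M0 /andP[p1 p2].
have W0 : 0 <= W by rewrite (le_trans _ zW)// powR_ge0.
have A : a * c * tau <= a ^+ 2 * tau / 8 + 2 * tau * c ^+ 2.
  by have := ler_wpM2r (ltW t0) (sqr_ge0 (a - 4 * c)); rewrite mul0r; nra.
have t1 : 0 <= a ^+ 2 * W * M `^ (2 - p) / (8 * tau).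
  rewrite divr_ge0//; last by rewrite mulr_ge0// ltW.
  by rewrite mulr_ge0 ?powR_ge0// mulr_ge0// sqr_ge0.
have t2 : 0 <= a * W * M `^ (1 - p) by rewrite mulr_ge0 ?powR_ge0// mulr_ge0.
have t3 : 0 <= 2 * tau * c ^+ 2 by rewrite mulr_ge0 ?sqr_ge0// mulr_ge0// ltW.
suff : a * c * z <= 2 * tau * c ^+ 2 + a ^+ 2 * W * M `^ (2 - p) / (8 * tau)
     + a * W * M `^ (1 - p) by lra.
have [zM|Mz] := leP z M.
  have z2 : z ^+ 2 <= W * M `^ (2 - p).
    rewrite (sqr_powR p z0) ler_pM ?powR_ge0//.
    by apply: ge0_ler_powR; rewrite ?subr_ge0// nnegrE ltW.
  have B : a * c * z <= 2 * tau * c ^+ 2 + a ^+ 2 * z ^+ 2 / (8 * tau).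
    have /(congr1 (fun y => 0 <= y)) : (a * z - 4 * tau * c) ^+ 2 / (8 * tau) =
        2 * tau * c ^+ 2 + a ^+ 2 * z ^+ 2 / (8 * tau) - a * c * z.
      by field; rewrite gt_eqF.
    by rewrite subr_ge0 => <-; rewrite divr_ge0 ?sqr_ge0// mulr_ge0// ltW.
  have : a ^+ 2 * z ^+ 2 / (8 * tau) <= a ^+ 2 * W * M `^ (2 - p) / (8 * tau).
    rewrite ler_pM2r ?invr_gt0 ?mulr_gt0// -mulrA.
    by rewrite ler_wpM2l ?sqr_ge0.
  by lra.
have z1 : z <= W * M `^ (1 - p).
  by rewrite (le_trans (le_powR_trunc M0 (ltW Mz) (ltW p1)))// ler_wpM2r ?powR_ge0.
have : a * c * z <= a * W * M `^ (1 - p).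
  by rewrite -!mulrA ler_wpM2l// (le_trans _ z1)// ler_piMl.
by lra.
Qed.

End scalar.

(** * Smooth functions and AdaGrad-Norm trajectories *)

Section smooth.
Context {R : realType} {d : nat}.
Variables (f : 'rV[R]_d -> R) (L : 'rV[R]_d).
Hypothesis smooth : forall y z,
  `|f y - f z - dot (gradient f z) (y - z)| <= 2^-1 * weighted_norm2 L (y - z).

Lemma smooth_l2 y z :
  `|f y - f z - dot (gradient f z) (y - z)|
    <= linfnorm L / 2 * l2norm (y - z) ^+ 2.
Proof.
have := smooth y z; have := weighted_norm2_le L (y - z).
by move: (weighted_norm2 _ _) => W; lra.
Qed.

(** The two-sided quadratic bound at (y + h, y), (y + h, z) and (y, z) controls
    <grad f y - grad f z, h>; take h of length delta along the difference of
    the gradients.  The sharp constant is 1 instead of 3. *)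
Lemma gradient_lipschitz y z delta : 0 < delta -> l2norm (y - z) <= delta ->
  l2norm (gradient f y - gradient f z) <= 3 * linfnorm L * delta.
Proof.
move=> delta0 yz.
set D := gradient f y - gradient f z.
have L0 : 0 <= linfnorm L := linfnorm_ge0 L.
have [->|D0] := eqVneq (l2norm D) 0; first by rewrite !mulr_ge0// ltW.
have {}D0 : 0 < l2norm D by rewrite lt_def D0 l2norm_ge0.
pose h := (delta / l2norm D) *: D.
have hn : l2norm h = delta.
  by rewrite l2normZ ger0_norm ?divr_ge0 ?ltW// divfK// gt_eqF.
have Dh : dot D h = delta * l2norm D.
  by rewrite dotZr dotxx expr2 mulrA divfK// gt_eqF.
have sq2 (u : 'rV[R]_d) r : l2norm u <= r ->
    linfnorm L / 2 * l2norm u ^+ 2 <= linfnorm L / 2 * r ^+ 2.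
  move=> ur; rewrite ler_wpM2l ?divr_ge0//.
  by rewrite lerXn2r ?nnegrE ?l2norm_ge0// (le_trans _ ur)// l2norm_ge0.
have := smooth_l2 (y + h) y; have := smooth_l2 (y + h) z; have := smooth_l2 y z.
rewrite !ler_norml => /andP[lo_z _] /andP[_ up_z] /andP[lo_y _].
have yhy : y + h - y = h by rewrite addrC addKr.
have yhz : y + h - z = (y - z) + h by rewrite addrAC.
move: lo_y up_z Dh; rewrite yhy yhz dotDr dotBl => lo_y up_z Dh.
have e1 := sq2 _ _ yz.
have e2 : linfnorm L / 2 * l2norm h ^+ 2 <= linfnorm L / 2 * delta ^+ 2.
  by apply: sq2; rewrite hn.
have e3 : linfnorm L / 2 * l2norm (y - z + h) ^+ 2
    <= linfnorm L / 2 * (2 * delta) ^+ 2.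
  by apply: sq2; rewrite (le_trans (l2norm_triangle _ _))// hn; lra.
have : delta * l2norm D <= delta * (3 * linfnorm L * delta).
  rewrite -Dh -/D; move: e1 e2 e3 lo_y up_z lo_z.
  have -> : linfnorm L / 2 * (2 * delta) ^+ 2 = 2 * linfnorm L * delta ^+ 2 by field.
  have -> : delta * (3 * linfnorm L * delta) = 3 * linfnorm L * delta ^+ 2 by ring.
  by lra.
by rewrite ler_pM2l.
Qed.

End smooth.

Section trajectory.
Context {disp : measure_display} {Omega : measurableType disp}.
Context {R : realType} {d : nat}.
Variables (f : 'rV[R]_d -> R) (L : 'rV[R]_d).
Hypothesis smooth : forall y z,
  `|f y - f z - dot (gradient f z) (y - z)| <= 2^-1 * weighted_norm2 L (y - z).
Hypothesis f_lb : has_lbound (range f).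
Variables (gamma lambda : R) (x1 : 'rV[R]_d) (g : nat -> Omega -> 'rV[R]_d)
  (v : nat -> Omega -> R) (x : nat -> Omega -> 'rV[R]_d).
Hypotheses (gamma0 : 0 < gamma) (lambda0 : 0 < lambda).
Hypothesis adagrad : adagrad_norm gamma lambda x1 g v x.

Definition grad_norm t w := l2norm (gradient f (x t w)).
Definition noise t w := g t w - gradient f (x t w).
Definition denom t w := lambda + Num.sqrt (v t w).
(** The random denominator with the stochastic gradient replaced by quantities
    of the past; tau stands for the size of the noise. *)
Definition proxy tau t w :=
  lambda + Num.sqrt (v t.-1 w + (grad_norm t w + tau) ^+ 2).

Lemma accumulator_sum t w : v t w = \sum_(1 <= s < t.+1) l2norm (g s w) ^+ 2.
Proof.
have [v0 _ step] := adagrad w.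
elim: t => [|t IH]; first by rewrite big_geq.
by rewrite big_nat_recr//= -IH; have [->] := step t.+1 isT.
Qed.

Lemma accumulator_ge0 t w : 0 <= v t w.
Proof. by rewrite accumulator_sum sumr_ge0// => s _; exact: sqr_ge0. Qed.

Lemma accumulatorS t w : (0 < t)%N -> v t w = v t.-1 w + l2norm (g t w) ^+ 2.
Proof. by move=> t0; have [_ _ /(_ t t0)[]] := adagrad w. Qed.

Lemma accumulator_le s t w : (s <= t)%N -> v s w <= v t w.
Proof.
move=> st; rewrite !accumulator_sum [leRHS](big_cat_nat _ (n := s.+1))//= lerDl.
by rewrite sumr_ge0// => i _; exact: sqr_ge0.
Qed.

Lemma denom_gt0 t w : 0 < denom t w.
Proof. by rewrite ltr_pwDl// sqrtr_ge0. Qed.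

Lemma proxy_gt0 tau t w : 0 < proxy tau t w.
Proof. by rewrite ltr_pwDl// sqrtr_ge0. Qed.

Lemma stochastic_gradient_le_denom t w : (0 < t)%N -> l2norm (g t w) <= denom t w.
Proof.
move=> t0; rewrite /denom (accumulatorS _ t0) -[leLHS]ger0_norm ?l2norm_ge0//.
rewrite -sqrtr_sqr (le_trans (_ : _ <= Num.sqrt (v t.-1 w + l2norm (g t w) ^+ 2)))//.
  by rewrite ler_sqrt ?addr_ge0 ?accumulator_ge0 ?sqr_ge0// lerDr accumulator_ge0.
by rewrite lerDr ltW.
Qed.

Lemma step_le t w : (0 < t)%N -> l2norm (x t.+1 w - x t w) <= gamma.
Proof.
move=> t0; have [_ _ /(_ t t0)[_ ->]] := adagrad w.
rewrite addrC addKr l2normN l2normZ -/(denom t w) ger0_norm; last first.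
  by rewrite divr_ge0// ltW// denom_gt0.
by rewrite mulrAC ler_pdivrMr ?denom_gt0// ler_pM2l// stochastic_gradient_le_denom.
Qed.

(** Every step of AdaGrad-Norm has length at most gamma, so gradients grow at
    most linearly along a trajectory, whatever the noise. *)
Lemma grad_norm_le T t w : (0 < t <= T)%N ->
  grad_norm t w <= l2norm (gradient f x1) + 3 * gamma * linfnorm L * T%:R.
Proof.
have Lg : 0 <= gamma * linfnorm L by rewrite mulr_ge0 ?linfnorm_ge0// ltW.
have grow s : grad_norm s.+1 w <= l2norm (gradient f x1) + 3 * gamma * linfnorm L * s%:R.
  elim: s => [|s IH].
    by rewrite /grad_norm; have [_ -> _] := adagrad w; rewrite mulr0 addr0.
  have := gradient_lipschitz smooth gamma0 (step_le w (ltn0Sn s)).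
  have := le_trans (ler_norm _)
    (l2norm_lipschitz (gradient f (x s.+2 w)) (gradient f (x s.+1 w))).
  move: IH; rewrite /grad_norm -[s.+1%:R]natr1; lra.
case: t => [//|t] /= tT; apply: le_trans (grow t) _.
rewrite lerD2l -!mulrA ler_pM2l// !mulrA.
by apply: ler_wpM2l => //; rewrite ler_nat ltnW.
Qed.

(** Telescoping of the smoothness inequality. *)
Lemma descent_sum T w :
  \sum_(1 <= t < T.+1) dot (gradient f (x t w)) (g t w) / denom t w
    <= (f x1 - inf (range f)) / gamma
       + gamma * linfnorm L / 2
         * \sum_(1 <= t < T.+1) (l2norm (g t w) / denom t w) ^+ 2.
Proof.
have tele : gamma * \sum_(1 <= t < T.+1) dot (gradient f (x t w)) (g t w) / denom t w
    <= f x1 - f (x T.+1 w) + gamma ^+ 2 * linfnorm L / 2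
         * \sum_(1 <= t < T.+1) (l2norm (g t w) / denom t w) ^+ 2.
  elim: T => [|T IH].
    by rewrite !big_geq// !mulr0 addr0; have [_ -> _] := adagrad w; rewrite subrr.
  rewrite !(big_nat_recr T.+1)//= !mulrDr.
  have c0 : 0 <= gamma / denom T.+1 w by rewrite divr_ge0 ?ltW ?denom_gt0.
  have xS : x T.+2 w - x T.+1 w = - (gamma / denom T.+1 w) *: g T.+1 w.
    have [_ _ /(_ T.+1 isT)[_ ->]] := adagrad w.
    by rewrite addrC addKr scaleNr.
  have := smooth_l2 smooth (x T.+2 w) (x T.+1 w).
  rewrite xS dotZr l2normZ normrN (ger0_norm c0).
  rewrite ler_norml => /andP[_].
  have -> : gamma / denom T.+1 w * l2norm (g T.+1 w)
      = gamma * (l2norm (g T.+1 w) / denom T.+1 w) by ring.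
  have -> : - (gamma / denom T.+1 w) * dot (gradient f (x T.+1 w)) (g T.+1 w)
      = - (gamma * (dot (gradient f (x T.+1 w)) (g T.+1 w) / denom T.+1 w)) by ring.
  rewrite exprMn; move: IH.
  move: (l2norm _ / _) (dot _ _ / _) => q r; lra.
have inf_le : inf (range f) <= f (x T.+1 w).
  by apply: ge_inf => //; exists (x T.+1 w).
rewrite -(ler_pM2l gamma0) mulrDr [gamma * (_ / gamma)]mulrC divfK ?gt_eqF//.
apply: (le_trans tele); rewrite lerD ?lerB//.
by rewrite !mulrA expr2.
Qed.

(** The sum telescopes to 2 ln (b_T / lambda); the concave logarithm is then
    replaced by its tangent at K, which is affine in b_T and can be integrated. *)
Lemma sqr_ratio_sum_le T w (K : R) : 0 < K ->
  \sum_(1 <= t < T.+1) (l2norm (g t w) / denom t w) ^+ 2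
    <= 2 * (ln K + denom T w / (lambda * K) - 1).
Proof.
move=> K0.
have tele : \sum_(1 <= t < T.+1) (l2norm (g t w) / denom t w) ^+ 2
    <= 2 * (ln (denom T w) - ln lambda).
  elim: T => [|T IH].
    rewrite big_geq// /denom; have [-> _ _] := adagrad w.
    by rewrite sqrtr0 addr0 subrr mulr0.
  rewrite big_nat_recr//=.
  have bE : denom T.+1 w = lambda + Num.sqrt (v T w + l2norm (g T.+1 w) ^+ 2).
    by rewrite /denom (accumulatorS _ (ltn0Sn T)).
  have := sqr_ratio_le_ln bE lambda0 (accumulator_ge0 T w).
  by rewrite -/(denom T w); lra.
apply: le_trans tele _; rewrite ler_pM2l//.
have lK0 : 0 < lambda * K by rewrite mulr_gt0.
have := @le_ln1Dx R (denom T w / (lambda * K) - 1).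
rewrite subrKC ltrBrDl subrr divr_gt0 ?denom_gt0// => /(_ isT).
rewrite ln_div ?posrE ?denom_gt0// lnM ?posrE//; lra.
Qed.

Lemma sqrt_accumulator_le T w :
  Num.sqrt (v T w) <= 2 * Num.sqrt (\sum_(1 <= t < T.+1) l2norm (noise t w) ^+ 2)
                    + 2 * Num.sqrt (\sum_(1 <= t < T.+1) grad_norm t w ^+ 2).
Proof.
set X := \sum_(1 <= t < T.+1) l2norm (noise t w) ^+ 2.
set Y := \sum_(1 <= t < T.+1) grad_norm t w ^+ 2.
have X0 : 0 <= X by rewrite sumr_ge0// => t _; exact: sqr_ge0.
have Y0 : 0 <= Y by rewrite sumr_ge0// => t _; exact: sqr_ge0.
have vXY : v T w <= 2 * X + 2 * Y.
  rewrite accumulator_sum !mulr_sumr -big_split; apply: ler_sum => t _ /=.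
  have : l2norm (g t w) <= l2norm (noise t w) + grad_norm t w.
    by have := l2norm_triangle (noise t w) (gradient f (x t w)); rewrite subrK.
  have z0 : 0 <= l2norm (noise t w) by exact: l2norm_ge0.
  have n0 : 0 <= grad_norm t w by exact: l2norm_ge0.
  move=> /(@lerXn2r _ 2 _ _ (l2norm_ge0 _) (addr_ge0 z0 n0)) /le_trans -> //.
  by have := sqr_ge0 (l2norm (noise t w) - grad_norm t w); nra.
have sX := sqrtr_ge0 X; have sY := sqrtr_ge0 Y.
rewrite -(@ler_pXn2r _ 2)// ?nnegrE ?addr_ge0 ?mulr_ge0 ?sqrtr_ge0//.
rewrite sqr_sqrtr ?accumulator_ge0// (le_trans vXY)//.
rewrite -{1}(sqr_sqrtr X0) -{1}(sqr_sqrtr Y0).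
move: (Num.sqrt X) (Num.sqrt Y) sX sY => a b; nra.
Qed.

(** With G the left side, every beta_t is at most
    B = lambda + tau + sqrt v_T + G, so G^2 <= B D for the energy D.  Then
    2 G <= kappa D + B / kappa, and kappa >= 3 absorbs the multiple 3 G / kappa
    hidden in B. *)
Lemma sum_sqr_grad_norm_le T tau kappa w : 0 <= tau -> 3 <= kappa ->
  Num.sqrt (\sum_(1 <= t < T.+1) grad_norm t w ^+ 2)
    <= kappa * \sum_(1 <= t < T.+1) grad_norm t w ^+ 2 / proxy tau t w
     + (lambda + tau + 2 * Num.sqrt (\sum_(1 <= t < T.+1) l2norm (noise t w) ^+ 2))
       / kappa.
Proof.
move=> tau0 kappa3.
have k0 : 0 < kappa by rewrite (lt_le_trans _ kappa3).
have vZG := sqrt_accumulator_le T w.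
set Z := Num.sqrt (\sum_(1 <= t < T.+1) l2norm (noise t w) ^+ 2) in vZG *.
set Y := \sum_(1 <= t < T.+1) grad_norm t w ^+ 2 in vZG *.
set D := \sum_(1 <= t < T.+1) _ / _.
have Y0 : 0 <= Y by rewrite sumr_ge0// => t _; exact: sqr_ge0.
have Z0 : 0 <= Z := sqrtr_ge0 _.
set G := Num.sqrt Y in vZG *; have G0 : 0 <= G := sqrtr_ge0 _.
pose B := lambda + tau + Num.sqrt (v T w) + G.
have B0 : 0 < B by rewrite /B -!addrA ltr_pwDl// !addr_ge0 ?sqrtr_ge0.
have YD : Y <= B * D.
  rewrite /D mulr_sumr /Y big_nat_cond [leRHS]big_nat_cond.
  apply: ler_sum => t /andP[/andP[t1 tT] _].
  rewrite mulrCA ler_peMr ?sqr_ge0// ler_pdivlMr ?proxy_gt0// mul1r.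
  have nG : grad_norm t w <= G.
    rewrite -[grad_norm t w]ger0_norm ?l2norm_ge0// -sqrtr_sqr ler_sqrt//.
    rewrite /Y (big_rem t) /=; last by rewrite mem_index_iota t1.
    by rewrite lerDl sumr_ge0// => i _; exact: sqr_ge0.
  have vt : Num.sqrt (v t.-1 w) <= Num.sqrt (v T w).
    rewrite ler_sqrt ?accumulator_ge0// accumulator_le//.
    by rewrite (leq_trans (leq_pred t)).
  have n0 : 0 <= grad_norm t w := l2norm_ge0 _.
  have := sqrt_add_sqr_lipschitz (grad_norm t w + tau) 0 (accumulator_ge0 t.-1 w).
  rewrite expr0n/= addr0 subr0 [`|_ + tau|]ger0_norm ?addr_ge0// => /(le_trans (ler_norm _)).
  by rewrite /proxy /B; lra.
have GD : G ^+ 2 <= B * D by rewrite sqr_sqrtr.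
have D0 : 0 <= D.
  by rewrite sumr_ge0// => t _; rewrite divr_ge0 ?sqr_ge0// ltW// proxy_gt0.
have BGle : B <= lambda + tau + 2 * Z + 3 * G by rewrite /B; lra.
have GkD : 2 * G <= kappa * D + B / kappa.
  rewrite -(ler_pM2l k0) mulrDr [kappa * (B / kappa)]mulrC divfK ?gt_eqF//.
  have kD : 0 <= kappa * (kappa * D) + B by apply: addr_ge0; rewrite ?mulr_ge0// ltW.
  rewrite -(@ler_pXn2r _ 2)// ?nnegrE ?(mulr_ge0 (ltW k0)) ?mulr_ge0//.
  have := ler_wpM2l (sqr_ge0 kappa) GD.
  have := sqr_ge0 (kappa * (kappa * D) - B); lra.
have : B / kappa <= (lambda + tau + 2 * Z) / kappa + G.
  rewrite ler_pdivrMr// mulrDl divfK ?gt_eqF//.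
  by rewrite (le_trans BGle)// lerD2l mulrC ler_wpM2l.
by lra.
Qed.

End trajectory.

(** The deviations of n from its mean have a nonnegative sum of squares. *)
Lemma sum_le_sqrt {R : realType} (T : nat) (n : nat -> R) :
  \sum_(1 <= t < T.+1) n t
    <= Num.sqrt T%:R * Num.sqrt (\sum_(1 <= t < T.+1) n t ^+ 2).
Proof.
case: T => [|T]; first by rewrite big_geq// sqrtr0 mul0r.
set S := \sum_(1 <= t < _) n t; set Y := \sum_(1 <= t < _) n t ^+ 2.
have Y0 : 0 <= Y by rewrite sumr_ge0// => t _; exact: sqr_ge0.
have T0 : 0 < T.+1%:R :> R by rewrite ltr0n.
rewrite -sqrtrM ?(ltW T0)// (le_trans (ler_norm _))// -sqrtr_sqr ler_sqrt ?mulr_ge0 ?(ltW T0)//.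
have expand c : \sum_(1 <= t < T.+2) (n t - c) ^+ 2 = Y - 2 * c * S + c ^+ 2 * T.+1%:R.
  have -> : c ^+ 2 * T.+1%:R = \sum_(1 <= t < T.+2) c ^+ 2.
    by rewrite sumr_const_nat subSS subn0 mulr_natr.
  by rewrite /S /Y mulr_sumr -sumrB -big_split; apply: eq_bigr => t _ /=; ring.
have : 0 <= \sum_(1 <= t < T.+2) (n t - S / T.+1%:R) ^+ 2.
  by rewrite sumr_ge0// => t _; exact: sqr_ge0.
rewrite expand.
have -> : Y - 2 * (S / T.+1%:R) * S + (S / T.+1%:R) ^+ 2 * T.+1%:R
    = (T.+1%:R * Y - S ^+ 2) / T.+1%:R by field; rewrite gt_eqF.
by rewrite pmulr_lge0 ?invr_gt0// subr_ge0.
Qed.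

(** * Integrals against bounded factors *)

Section expectations.
Context {disp : measure_display} {Omega : measurableType disp} {R : realType}.
Variable P : probability Omega R.
Implicit Types (X Y H : Omega -> R) (G : set (set Omega)).

Lemma integrable_real_measurable X : P.-integrable setT (EFin \o X) ->
  measurable_fun setT X.
Proof. by move=> /integrableP[/measurable_EFinP]. Qed.

Lemma integrable_real_cst (c : R) : P.-integrable setT (EFin \o (fun=> c)).
Proof. exact: finite_measure_integrable_cst. Qed.

Lemma integrable_real_D X Y : P.-integrable setT (EFin \o X) ->
  P.-integrable setT (EFin \o Y) -> P.-integrable setT (EFin \o (fun w => X w + Y w)).
Proof. by move=> iX iY; apply: eq_integrable (integrableD _ iX iY). Qed.

Lemma integrable_real_B X Y : P.-integrable setT (EFin \o X) ->
  P.-integrable setT (EFin \o Y) -> P.-integrable setT (EFin \o (fun w => X w - Y w)).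
Proof. by move=> iX iY; apply: eq_integrable (integrableB _ iX iY). Qed.

Lemma integrable_real_Z c X : P.-integrable setT (EFin \o X) ->
  P.-integrable setT (EFin \o (fun w => c * X w)).
Proof. by move=> iX; apply: eq_integrable (integrableZl _ c iX). Qed.

Lemma integrable_real_sum (I : eqType) (s : seq I) (X : I -> Omega -> R) :
  (forall i, i \in s -> P.-integrable setT (EFin \o X i)) ->
  P.-integrable setT (EFin \o (fun w => \sum_(i <- s) X i w)).
Proof.
move=> iX; have := integrable_sum measurableT s iX.
by apply: eq_integrable => // w _ /=; rewrite -big_seq sumEFin.
Qed.

Lemma Rintegral_sum (I : eqType) (s : seq I) (X : I -> Omega -> R) :
  (forall i, i \in s -> P.-integrable setT (EFin \o X i)) ->
  \int[P]_w (\sum_(i <- s) X i w) = \sum_(i <- s) \int[P]_w X i w.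
Proof.
elim: s => [|i s IH] iX.
  under eq_Rintegral do rewrite big_nil.
  by rewrite big_nil Rintegral_cst// mul0r.
have iXs j : j \in s -> P.-integrable setT (EFin \o X j).
  by move=> js; apply: iX; rewrite in_cons js orbT.
rewrite big_cons -IH// -RintegralD//; last 2 first.
- by apply: iX; rewrite mem_head.
- exact: integrable_real_sum.
by apply: eq_Rintegral => w _; rewrite big_cons.
Qed.

Lemma Rintegral_probability_cst (c : R) : \int[P]_w c = c.
Proof.
by rewrite Rintegral_cst//= [fine _](_ : _ = 1) ?mulr1// probability_setT.
Qed.

Lemma integrable_bounded_mul H X (c : R) : measurable_fun setT H ->
  (forall w, `|H w| <= c) -> P.-integrable setT (EFin \o X) ->
  P.-integrable setT (EFin \o (fun w => H w * X w)).
Proof.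
move=> mH Hc iX.
apply: (@le_integrable _ _ _ _ _ measurableT _ (EFin \o (fun w => c * X w))).
- by apply/measurable_EFinP; apply: measurable_funM => //; exact: integrable_real_measurable.
- move=> w _ /=; rewrite lee_fin !normrM ler_wpM2r//.
  by rewrite (le_trans (Hc w))// ler_norm.
- exact: integrable_real_Z.
Qed.

Lemma integrable_bounded H (c : R) : measurable_fun setT H ->
  (forall w, `|H w| <= c) -> P.-integrable setT (EFin \o H).
Proof.
move=> mH Hc; apply: eq_integrable (integrable_bounded_mul mH Hc (integrable_real_cst 1)) => //.
by move=> w _ /=; rewrite mulr1.
Qed.

(** The sum counts the integers of [1, n] that are at most y; it is the integral
    part of y. *)
Lemma staircase_sum (n : nat) (y : R) : 0 <= y <= n%:R ->
  \sum_(1 <= k < n.+1) ((k%:R : R) <= y)%R%:R <= y <= \sum_(1 <= k < n.+1) ((k%:R : R) <= y)%R%:R + 1.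
Proof.
move=> /andP[y0 yn].
pose s m := \sum_(1 <= k < m.+1) ((k%:R : R) <= y)%R%:R : R.
have sm m : s m <= m%:R.
  rewrite /s (le_trans (_ : _ <= \sum_(1 <= k < m.+1) 1))//.
    by apply: ler_sum => k _; rewrite lern1 leq_b1.
  by rewrite sumr_const_nat subSS subn0.
have : s n <= y /\ (y <= s n + 1 \/ s n = n%:R).
  elim: n {yn} => [|n [IH1 IH2]].
    by rewrite /s big_geq//; split => //; right.
  rewrite /s big_nat_recr//= -/(s n).
  have [ny|yn] := leP n.+1%:R y; last first.
    by rewrite addr0; split => //; left; case: IH2 => [//|->]; rewrite natr1 ltW.
  have sn : s n = n%:R.
    case: IH2 => // ysn; apply/eqP; rewrite eq_le sm/=.
    by move: ny; rewrite -natr1 => ny; move: (le_trans ny ysn); rewrite lerD2r.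
  by rewrite sn natr1; split => //; right.
by rewrite -/(s n) => -[-> /= [//|->]]; rewrite (le_trans yn)// lerDl.
Qed.

(** H is uniformly within 1 / n of the average of the indicators of the sets
    where H >= k / n, for k = 1, ..., n.  These sets belong to G, so each
    indicator integrates to 0 against Z. *)
Lemma Rintegral_bounded_mul_eq0 G H Z : G `<=` measurable ->
  (forall B : set R, measurable B -> G (H @^-1` B)) ->
  (forall w, 0 <= H w <= 1) ->
  P.-integrable setT (EFin \o Z) ->
  (forall A, G A -> \int[P]_(w in A) Z w = 0) ->
  \int[P]_w (H w * Z w) = 0.
Proof.
move=> GM GH H01 iZ Z0.
have mH : measurable_fun setT H.
  by move=> _ B mB; rewrite setTI; apply: GM; exact: GH.
have Hb w : `|H w| <= 1.
  by have /andP[h0 h1] := H01 w; rewrite ger0_norm.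
have iHZ := integrable_bounded_mul mH Hb iZ.
have main n : `|\int[P]_w (H w * Z w)| <= n.+1%:R^-1 * \int[P]_w `|Z w|.
  pose A k := H @^-1` `[k%:R / n.+1%:R, +oo[.
  have GA k : G (A k) by apply: GH.
  have mA k : measurable (A k) by exact: GM.
  pose S w := n.+1%:R^-1 * \sum_(1 <= k < n.+2) (Z \_ (A k)) w.
  have iA k : P.-integrable setT (EFin \o (Z \_ (A k))).
    rewrite -restrict_EFin; apply/integrable_restrict => //.
    by rewrite setTI; apply: integrableS iZ.
  have iS : P.-integrable setT (EFin \o S).
    by apply: integrable_real_Z; exact: integrable_real_sum.
  have S0 : \int[P]_w S w = 0.
    rewrite /S RintegralZl//; last exact: integrable_real_sum.
    rewrite Rintegral_sum// big1 ?mulr0// => k _.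
    by rewrite -Rintegral_mkcond Z0.
  have -> : \int[P]_w (H w * Z w) = \int[P]_w (H w * Z w - S w).
    by rewrite RintegralB// S0 subr0.
  apply: le_trans (le_normr_Rintegral _ _) _ => //; first exact: integrable_real_B.
  rewrite -RintegralZl//; last exact: integrable_norm.
  apply: le_Rintegral => //.
  - by apply: integrable_norm; exact: integrable_real_B.
  - by apply: integrable_real_Z; exact: integrable_norm.
  move=> w _ /=.
  have n0 : 0 < n.+1%:R :> R by rewrite ltr0n.
  have -> : H w * Z w - S w = n.+1%:R^-1 * ((n.+1%:R * H w
      - \sum_(1 <= k < n.+2) ((k%:R : R) <= n.+1%:R * H w)%R%:R) * Z w).
    rewrite mulrBl mulrBr -mulrA mulKf ?gt_eqF// /S; congr (_ - _ * _).
    rewrite mulr_suml; apply: eq_bigr => k _.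
    rewrite patchE; case: ifPn => [|/negP]; rewrite in_setE /A /= in_itv/= andbT.
      by rewrite ler_pdivrMr// mulrC => ->; rewrite mul1r.
    by rewrite ler_pdivrMr// mulrC => /negP/negbTE ->; rewrite mul0r.
  rewrite normrM ger0_norm ?invr_ge0 ?ler0n// ler_pM2l ?invr_gt0// normrM ler_piMl//.
  have /andP[h0 h1] := H01 w.
  have /staircase_sum/andP[s1 s2] : 0 <= n.+1%:R * H w <= n.+1%:R.
    by rewrite mulr_ge0//= ler_piMr.
  rewrite ger0_norm ?subr_ge0//; lra.
apply/eqP; rewrite -normr_le0; apply/ler_addgt0Pr => e e0; rewrite add0r.
set c := \int[P]_w `|Z w| in main.
have c0 : 0 <= c by apply: Rintegral_ge0.
(* n + 1 exceeds c / e. *)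
pose n := Num.trunc (c / e).
rewrite (le_trans (main n))// mulrC ler_pdivrMr ?ltr0n// mulrC -ler_pdivrMr//.
by rewrite ltW// truncnS_gt.
Qed.

End expectations.

(** * Conditional expectation and the natural filtration *)

Section conditional.
Context {disp : measure_display} {Omega : measurableType disp} {R : realType}.
Variable P : probability Omega R.
Implicit Types (X Y H : Omega -> R) (G : set (set Omega)).

(** The defining property of the conditional expectation extends from the
    indicators of G to bounded G-measurable factors; (1 + H) / 2 has values in
    [0, 1], as the staircase approximation requires. *)
Lemma cond_expectation_bounded_mul G X Y H : G `<=` measurable ->
  is_cond_expectation P G X Y ->
  (forall B : set R, measurable B -> G (H @^-1` B)) ->
  (forall w, `|H w| <= 1) ->
  \int[P]_w (H w * X w) = \int[P]_w (H w * Y w).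
Proof.
move=> GM [iX iY mY XY] GH H1.
have mH : measurable_fun setT H.
  by move=> _ B mB; rewrite setTI; apply: GM; exact: GH.
pose Z w := X w - Y w.
have iZ : P.-integrable setT (EFin \o Z) by exact: integrable_real_B.
have Z0 A : G A -> \int[P]_(w in A) Z w = 0.
  move=> GA; have mA := GM _ GA.
  rewrite /Z RintegralB//; [|exact: integrableS iX|exact: integrableS iY].
  by apply/eqP; rewrite subr_eq0; apply/eqP; rewrite /Rintegral XY.
have ZT : \int[P]_w Z w = 0.
  by apply: Z0; rewrite -(preimage_setT H); apply: GH.
pose K w := (1 + H w) / 2.
have GK (B : set R) : measurable B -> G (K @^-1` B).
  move=> mB; rewrite (_ : K @^-1` B = H @^-1` ((fun h => (1 + h) / 2) @^-1` B))//.
  apply: GH; rewrite -[X in measurable X]setTI.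
  have mf : measurable_fun setT (fun h : R => (1 + h) / 2).
    by apply: measurable_funM => //; exact: measurable_funD.
  exact: mf.
have K01 w : 0 <= K w <= 1.
  by have := H1 w; rewrite /K ler_norml => /andP[? ?]; apply/andP; split; lra.
have := Rintegral_bounded_mul_eq0 GM GK K01 iZ Z0.
have iHZ := integrable_bounded_mul mH H1 iZ.
have -> : \int[P]_w (K w * Z w) = 2^-1 * \int[P]_w (Z w + H w * Z w).
  rewrite -RintegralZl//; last exact: integrable_real_D.
  by apply: eq_Rintegral => w _; rewrite /K; field.
rewrite RintegralD// ZT add0r => /eqP; rewrite mulf_eq0 invr_eq0 pnatr_eq0/=.
move=> /eqP HZ0; apply/eqP; rewrite -subr_eq0 -HZ0.
rewrite -RintegralB//; [|exact: integrable_bounded_mul iX|exact: integrable_bounded_mul iY].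
by apply/eqP; apply: eq_Rintegral => w _; rewrite /Z mulrBr.
Qed.

(** An almost sure upper bound on E [X | G] may be used under the expectation
    against any G-measurable factor with values in [0, 1]. *)
Lemma cond_expectation_le_bounded_mul G X H c : G `<=` measurable ->
  cond_expectation_le P G X c ->
  (forall B : set R, measurable B -> G (H @^-1` B)) ->
  (forall w, 0 <= H w <= 1) ->
  \int[P]_w (H w * X w) <= c * \int[P]_w H w.
Proof.
move=> GM [Y [condY Yc]] GH H01.
have H1 w : `|H w| <= 1 by have /andP[h0 h1] := H01 w; rewrite ger0_norm.
have mH : measurable_fun setT H.
  by move=> _ B mB; rewrite setTI; apply: GM; exact: GH.
rewrite (cond_expectation_bounded_mul GM condY GH H1).
have [_ iY _ _] := condY.
have mY := integrable_real_measurable iY.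
have iH := integrable_bounded P mH H1.
have icY := integrable_real_B (integrable_real_cst P c) iY.
have -> : \int[P]_w (H w * Y w) = c * \int[P]_w H w - \int[P]_w (H w * (c - Y w)).
  rewrite -RintegralZl// -RintegralB//; [|exact: integrable_real_Z|].
    by apply: eq_Rintegral => w _; ring.
  exact: integrable_bounded_mul H1 icY.
rewrite lerBlDr lerDl.
have mHcY : measurable_fun setT (fun w => H w * (c - Y w)).
  by apply: measurable_funM => //; exact: measurable_funB.
rewrite (_ : \int[P]_w (H w * (c - Y w)) = \int[P]_w Num.max (H w * (c - Y w)) 0).
  by apply: Rintegral_ge0 => w _; rewrite le_max lexx orbT.
congr fine; apply: ae_eq_integral => //.
- exact/measurable_EFinP.
- by apply/measurable_EFinP; exact: measurable_maxr.
apply: filterS Yc => w Ywc _ /=; rewrite max_l// mulr_ge0 ?subr_ge0//.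
by have /andP[] := H01 w.
Qed.

End conditional.

Section filtration.
Context {disp : measure_display} {Omega : measurableType disp}.
Context {R : realType} {d : nat}.
Variables (g : nat -> Omega -> 'rV[R]_d).
Hypothesis g_measurable : forall t, (1 <= t)%N -> random_vector (g t).

Definition filtration_generator t : set (set Omega) :=
  \bigcup_(s in [set s | (1 <= s <= t)%N])
    \bigcup_(i in [set: 'I_d])
      preimage_set_system setT (fun w => g s w 0 i) (measurable : set (set R)).

Lemma natural_filtration_measurable t : natural_filtration g t `<=` measurable.
Proof.
apply: smallest_sub; first exact: sigma_algebra_measurable.
move=> A [s /= /andP[s1 _]] [i _] [B mB <-].
exact: g_measurable.
Qed.

(** Measurability with respect to the natural filtration as measurability on a
    type, so that the library's lemmas apply. *)
Definition past t := g_sigma_algebraType (filtration_generator t).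

(** Measurability with respect to the past, in the form used by the conditional
    expectation and in the form to which the measurability lemmas apply. *)
Lemma measurable_pastP t (H : Omega -> R) :
  measurable_fun setT (H : past t -> R) <->
  (forall B : set R, measurable B -> natural_filtration g t (H @^-1` B)).
Proof.
split=> [mH B mB|HB _ B mB].
  by have := mH measurableT B mB; rewrite setTI.
by rewrite setTI; exact: HB.
Qed.

Lemma measurable_past_gradient s t i : (1 <= s <= t)%N ->
  measurable_fun setT ((fun w => g s w 0 i) : past t -> R).
Proof.
move=> st; apply/measurable_pastP => B mB; apply: sub_sigma_algebra.
by exists s => //; exists i => //; exists B => //; rewrite setTI.
Qed.

End filtration.

Section measurable_algebra.
Context {disp : measure_display} {T : measurableType disp} {R : realType}.

Lemma measurable_fun_div (h k : T -> R) : (forall w, 0 < k w) ->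
  measurable_fun setT h -> measurable_fun setT k -> measurable_fun setT (fun w => h w / k w).
Proof.
move=> k0 mh mk; apply: measurable_funM => //.
have -> : (fun w => (k w)^-1) = (fun w => k w `^ (-1)).
  by apply/funext => w; rewrite powR_inv1// ltW.
exact: measurableT_comp (measurable_powR _) mk.
Qed.

Lemma measurable_fun_sqrt (h : T -> R) : measurable_fun setT h ->
  measurable_fun setT (fun w => Num.sqrt (h w)).
Proof.
move=> mh; apply: (measurableT_comp _ mh).
by apply: continuous_measurable_fun; exact: sqrt_continuous.
Qed.

Lemma measurable_l2norm d (X : T -> 'rV[R]_d) :
  (forall i, measurable_fun setT (fun w => X w 0 i)) ->
  measurable_fun setT (fun w => l2norm (X w)).
Proof.
move=> mX; apply: measurable_fun_sqrt; apply: measurable_sum => i.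
exact: measurable_funX.
Qed.

End measurable_algebra.

(** * Energy bound along a trajectory *)

Section pathwise.
Context {disp : measure_display} {Omega : measurableType disp}.
Context {R : realType} {d : nat}.
Variables (f : 'rV[R]_d -> R) (L : 'rV[R]_d) (p : R).
Hypothesis f_lb : has_lbound (range f).
Hypothesis smooth : forall y z,
  `|f y - f z - dot (gradient f z) (y - z)| <= 2^-1 * weighted_norm2 L (y - z).
Hypothesis p12 : 1 < p <= 2.
Variables (gamma lambda : R) (x1 : 'rV[R]_d) (g : nat -> Omega -> 'rV[R]_d)
  (v : nat -> Omega -> R) (x : nat -> Omega -> 'rV[R]_d).
Hypotheses (gamma0 : 0 < gamma) (lambda0 : 0 < lambda).
Hypothesis adagrad : adagrad_norm gamma lambda x1 g v x.
Variables (tau : R).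
Hypothesis tau0 : 0 < tau.

Local Notation nrm := (grad_norm f x).
Local Notation xi := (noise f g x).
Local Notation beta := (proxy f lambda v x tau).

Definition noise_moment t w := \sum_i `|xi t w 0 i| `^ p.
Definition proxy_ratio t w := nrm t w / beta t w.
Definition energy t w := nrm t w ^+ 2 / beta t w.
Definition drift t w := dot (gradient f (x t w)) (xi t w) / beta t w.

Lemma l2norm_noise_le t w : l2norm (xi t w) `^ p <= noise_moment t w.
Proof.
have /andP[p1 p2] := p12.
have -> : l2norm (xi t w) = Num.sqrt (\sum_i `|xi t w 0 i| ^+ 2).
  by rewrite /l2norm; congr Num.sqrt; apply: eq_bigr => i _; rewrite real_normK ?num_real.
by apply: powR_sqrt_sum_le => [|i]; rewrite ?normr_ge0// p2 (lt_trans ltr01).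
Qed.

(** Two uses of the comparison of l^2 and l^p norms, over time and over
    coordinates; the result is linear in the p-th moments. *)
Lemma total_noise_le T w m : 0 < m ->
  Num.sqrt (\sum_(1 <= t < T.+1) l2norm (xi t w) ^+ 2)
    <= m + m `^ (1 - p) * \sum_(1 <= t < T.+1) noise_moment t w.
Proof.
move=> m0; have /andP[p1 p2] := p12.
rewrite (le_trans (le_add_powR_trunc m0 (sqrtr_ge0 _) (ltW p1)))// lerD2l mulrC.
rewrite ler_wpM2l ?powR_ge0//.
apply: (@le_trans _ _ (\sum_(1 <= t < T.+1) l2norm (xi t w) `^ p)).
  by apply: powR_sqrt_sum_le => [|t]; rewrite ?l2norm_ge0// p2 (lt_trans ltr01).
by apply: ler_sum => t _; exact: l2norm_noise_le.
Qed.

Lemma grad_le_proxy t w : nrm t w + tau <= beta t w.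
Proof.
have n0 : 0 <= nrm t w := l2norm_ge0 _.
have : Num.sqrt ((nrm t w + tau) ^+ 2) <= Num.sqrt (v t.-1 w + (nrm t w + tau) ^+ 2).
  by rewrite ler_sqrt ?addr_ge0 ?(accumulator_ge0 adagrad) ?sqr_ge0// lerDr (accumulator_ge0 adagrad).
rewrite sqrtr_sqr ger0_norm ?addr_ge0 ?(ltW tau0)// => h.
by rewrite /proxy (le_trans h)// lerDr ltW.
Qed.

Lemma beta_gt0 t w : 0 < beta t w.
Proof. exact: proxy_gt0. Qed.

Lemma ratio01 t w : 0 <= proxy_ratio t w <= 1.
Proof.
have n0 : 0 <= nrm t w := l2norm_ge0 _.
rewrite /proxy_ratio divr_ge0 ?(ltW (beta_gt0 _ _))//= ler_pdivrMr ?beta_gt0// mul1r.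
by rewrite (le_trans _ (grad_le_proxy _ _))// lerDl ltW.
Qed.

(** The offset tau makes the denominator at least tau. *)
Lemma ratio_sqr_le_energy t w : proxy_ratio t w ^+ 2 * tau <= energy t w.
Proof.
rewrite /proxy_ratio /energy expr_div_n [_ ^+ 2 / beta t w]mulrC -mulrA [leLHS]mulrC.
rewrite ler_wpM2r ?sqr_ge0// mulrC ler_pdivrMr ?exprn_gt0 ?beta_gt0//.
rewrite expr2 mulKf ?gt_eqF ?beta_gt0//.
by rewrite (le_trans _ (grad_le_proxy _ _))// lerDr l2norm_ge0.
Qed.

Lemma energyE t w : energy t w = proxy_ratio t w * nrm t w.
Proof. by rewrite /energy /proxy_ratio expr2 mulrAC. Qed.

(** The descent with the true denominator, compared to the energy and to a
    term of mean zero, with errors that are linear in the noise moment. *)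
Lemma descent_one_step t w M : (0 < t)%N -> 0 < M ->
  energy t w + drift t w <= dot (gradient f (x t w)) (g t w) / denom lambda v t w
    + (proxy_ratio t w ^+ 2 * tau / 8 + 4 * tau * (l2norm (g t w) / denom lambda v t w) ^+ 2
     + proxy_ratio t w ^+ 2 * noise_moment t w * M `^ (2 - p) / (8 * tau)
     + proxy_ratio t w * noise_moment t w * M `^ (1 - p)).
Proof.
move=> t0 M0.
have bE : denom lambda v t w = lambda + Num.sqrt (v t.-1 w + l2norm (g t w) ^+ 2).
  by rewrite /denom (accumulatorS adagrad).
have b0 : 0 < denom lambda v t w by exact: denom_gt0.
have n0 : 0 <= nrm t w := l2norm_ge0 _.
have := descent_proxy (c := dot (gradient f (x t w)) (g t w)) (z := l2norm (xi t w))
  bE (erefl (beta t w)) lambda0 (accumulator_ge0 adagrad t.-1 w) n0 (l2norm_ge0 _)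
  (ltW tau0) (l2norm_lipschitz _ _) (cauchy_schwarz _ _).
have c01 : 0 <= l2norm (g t w) / denom lambda v t w <= 1.
  rewrite divr_ge0 ?l2norm_ge0 ?(ltW b0)//= ler_pdivrMr// mul1r.
  by rewrite (stochastic_gradient_le_denom lambda0 adagrad).
have /andP[a0 _] := ratio01 t w.
have := cross_term_le a0 c01 (l2norm_ge0 _) (l2norm_noise_le t w) tau0 M0 p12.
have -> : energy t w + drift t w = dot (gradient f (x t w)) (g t w) / beta t w.
  rewrite /energy /drift -mulrDl -[nrm t w ^+ 2]dotxx -dotDr /noise.
  by rewrite addrC subrK.
by rewrite -/(proxy_ratio t w); lra.
Qed.

Definition grad_bound T := l2norm (gradient f x1) + 3 * gamma * linfnorm L * T%:R.

Lemma grad_bound_ge0 T : 0 <= grad_bound T.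
Proof. by rewrite addr_ge0 ?l2norm_ge0// !mulr_ge0 ?linfnorm_ge0// ltW. Qed.

Lemma sqrt_sum_sqr_grad_le T w :
  Num.sqrt (\sum_(1 <= t < T.+1) nrm t w ^+ 2) <= Num.sqrt T%:R * grad_bound T.
Proof.
rewrite -[grad_bound T]ger0_norm ?grad_bound_ge0// -sqrtr_sqr -sqrtrM ?ler0n//.
rewrite ler_sqrt; last by rewrite mulr_ge0 ?ler0n ?sqr_ge0.
apply: (@le_trans _ _ (\sum_(1 <= t < T.+1) grad_bound T ^+ 2)); last first.
  by rewrite sumr_const_nat subSS subn0 mulr_natl.
rewrite big_nat_cond [leRHS]big_nat_cond; apply: ler_sum => t /andP[tT _].
apply: lerXn2r; rewrite ?nnegrE ?l2norm_ge0 ?grad_bound_ge0//.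
exact: (grad_norm_le smooth gamma0 lambda0 adagrad).
Qed.

(** A pathwise inequality whose left side is a sum of integrable terms, one per
    step, and whose right side is deterministic. *)
Lemma energy_sum_le T w (K m M : R) : 0 < K -> 0 < m -> 0 < M ->
  \sum_(1 <= t < T.+1) (7 / 8 * energy t w + drift t w
     - (gamma * linfnorm L / 2 + 4 * tau) * (4 * m `^ (1 - p) / (lambda * K))
       * noise_moment t w
     - M `^ (2 - p) / (8 * tau) * (proxy_ratio t w ^+ 2 * noise_moment t w)
     - M `^ (1 - p) * (proxy_ratio t w * noise_moment t w))
  <= (f x1 - inf (range f)) / gamma + (gamma * linfnorm L / 2 + 4 * tau)
     * (2 * (ln K - 1)
        + 2 * (lambda + 2 * (Num.sqrt T%:R * grad_bound T) + 2 * m) / (lambda * K)).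
Proof.
move=> K0 m0 M0.
set LQ := gamma * linfnorm L / 2 + 4 * tau.
have LQ0 : 0 <= LQ.
  by rewrite /LQ addr_ge0 ?mulr_ge0 ?linfnorm_ge0 ?(ltW gamma0) ?(ltW tau0).
set c := 4 * m `^ (1 - p) / (lambda * K).
set SW := \sum_(1 <= t < T.+1) noise_moment t w.
set Q := \sum_(1 <= t < T.+1) (l2norm (g t w) / denom lambda v t w) ^+ 2.
have Qle : Q <= 2 * (ln K - 1)
    + 2 * (lambda + 2 * (Num.sqrt T%:R * grad_bound T) + 2 * m) / (lambda * K) + c * SW.
  apply: le_trans (sqr_ratio_sum_le lambda0 adagrad T w K0) _.
  have vT := sqrt_accumulator_le f adagrad T w.
  have zT := total_noise_le T w m0.
  have GT := sqrt_sum_sqr_grad_le T w.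
  have lK0 : 0 < lambda * K by rewrite mulr_gt0.
  have : denom lambda v T w / (lambda * K) <=
     (lambda + 2 * (Num.sqrt T%:R * grad_bound T) + 2 * m + 2 * m `^ (1 - p) * SW) / (lambda * K).
    by rewrite ler_pM2r ?invr_gt0// /denom; rewrite -/SW in zT; lra.
  have -> : 2 * (ln K - 1) + 2 * (lambda + 2 * (Num.sqrt T%:R * grad_bound T) + 2 * m) / (lambda * K) + c * SW
     = 2 * (ln K - 1) + 2 * ((lambda + 2 * (Num.sqrt T%:R * grad_bound T) + 2 * m + 2 * m `^ (1 - p) * SW) / (lambda * K)).
    by rewrite /c; field; rewrite !gt_eqF.
  by lra.
have per t : (0 < t)%N -> 7 / 8 * energy t w + drift t w
     - M `^ (2 - p) / (8 * tau) * (proxy_ratio t w ^+ 2 * noise_moment t w)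
     - M `^ (1 - p) * (proxy_ratio t w * noise_moment t w)
   <= dot (gradient f (x t w)) (g t w) / denom lambda v t w
      + 4 * tau * (l2norm (g t w) / denom lambda v t w) ^+ 2.
  move=> t0; have := descent_one_step w t0 M0; have := ratio_sqr_le_energy t w.
  have -> : proxy_ratio t w ^+ 2 * noise_moment t w * M `^ (2 - p) / (8 * tau)
    = M `^ (2 - p) / (8 * tau) * (proxy_ratio t w ^+ 2 * noise_moment t w) by ring.
  have -> : proxy_ratio t w * noise_moment t w * M `^ (1 - p)
    = M `^ (1 - p) * (proxy_ratio t w * noise_moment t w) by ring.
  lra.
apply: (@le_trans _ _ (\sum_(1 <= t < T.+1)
    (dot (gradient f (x t w)) (g t w) / denom lambda v t w
     + 4 * tau * (l2norm (g t w) / denom lambda v t w) ^+ 2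
     - LQ * c * noise_moment t w))).
  rewrite big_nat_cond [leRHS]big_nat_cond; apply: ler_sum => t /andP[/andP[t1 _] _].
  by have := per t t1; lra.
rewrite big_split /= big_split /= -mulr_sumr sumrN -mulr_sumr -/Q -/SW.
have := descent_sum smooth f_lb gamma0 lambda0 adagrad T w; rewrite -/Q.
have := ler_wpM2l LQ0 Qle; rewrite mulrDr mulrA {1}/LQ; lra.
Qed.

End pathwise.

(** * Energy bound in expectation *)

Section expected.
Context {disp : measure_display} {Omega : measurableType disp}.
Context {R : realType} {d : nat}.
Variables (f : 'rV[R]_d -> R) (L sigma : 'rV[R]_d) (p : R).
Variable P : probability Omega R.
Hypothesis f_lb : has_lbound (range f).
Hypothesis smooth : forall y z,
  `|f y - f z - dot (gradient f z) (y - z)| <= 2^-1 * weighted_norm2 L (y - z).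
Hypothesis p12 : 1 < p <= 2.
Variables (gamma lambda : R) (x1 : 'rV[R]_d) (g : nat -> Omega -> 'rV[R]_d)
  (v : nat -> Omega -> R) (x : nat -> Omega -> 'rV[R]_d).
Hypotheses (gamma0 : 0 < gamma) (lambda0 : 0 < lambda).
Hypothesis g_measurable : forall t, (1 <= t)%N -> random_vector (g t).
Hypothesis adagrad : adagrad_norm gamma lambda x1 g v x.
Hypothesis unbiased : forall t i, (1 <= t)%N ->
  is_cond_expectation P (natural_filtration g t.-1)
    (fun w => g t w 0 i) (fun w => partial_deriv f i (x t w)).
Hypothesis heavy_tail : forall t i, (1 <= t)%N ->
  cond_expectation_le P (natural_filtration g t.-1)
    (fun w => `|g t w 0 i - partial_deriv f i (x t w)| `^ p) (sigma 0 i `^ p).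
Variable tau : R.
Hypothesis tau0 : 0 < tau.

Local Notation nrm := (grad_norm f x).
Local Notation xi := (noise f g x).
Local Notation beta := (proxy f lambda v x tau).
Local Notation W := (noise_moment f p g x).
Local Notation ratio := (proxy_ratio f lambda v x tau).
Local Notation energy := (energy f lambda v x tau).
Local Notation drift := (drift f lambda g v x tau).
Local Notation gbound := (grad_bound f L gamma x1).

Lemma noiseE t w i : xi t w 0 i = g t w 0 i - partial_deriv f i (x t w).
Proof. by rewrite /noise !mxE. Qed.

Lemma past_partial_deriv t i : (1 <= t)%N ->
  measurable_fun setT ((fun w => partial_deriv f i (x t w)) : past g t.-1 -> R).
Proof. by move=> t1; apply/measurable_pastP; have [_ _ + _] := unbiased i t1. Qed.

Lemma past_grad_norm t : (1 <= t)%N -> measurable_fun setT (nrm t : past g t.-1 -> R).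
Proof.
move=> t1; apply: measurable_l2norm => i.
by under eq_fun do rewrite mxE; exact: past_partial_deriv.
Qed.

(** v_s is a function of g_1, ..., g_s. *)
Lemma past_accumulator s t : (s <= t)%N -> measurable_fun setT (v s : past g t -> R).
Proof.
elim: s => [|s IH] st.
  rewrite (_ : v 0%N = fun=> 0); last by apply/funext => w; have [] := adagrad w.
  exact: measurable_cst.
rewrite (_ : v s.+1 = fun w => v s w + l2norm (g s.+1 w) ^+ 2); last first.
  by apply/funext => w; rewrite (accumulatorS adagrad).
apply: measurable_funD; first exact: (IH (ltnW st)).
by apply: measurable_funX; apply: measurable_l2norm => i; exact: measurable_past_gradient.
Qed.

Lemma past_proxy t : (1 <= t)%N -> measurable_fun setT (beta t : past g t.-1 -> R).
Proof.
move=> t1; apply: measurable_funD => //; apply: measurable_fun_sqrt.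
apply: measurable_funD; first exact: past_accumulator.
by apply: measurable_funX; apply: measurable_funD => //; exact: past_grad_norm.
Qed.

Lemma past_ratio t : (1 <= t)%N -> measurable_fun setT (ratio t : past g t.-1 -> R).
Proof.
move=> t1; apply: measurable_fun_div; [|exact: past_grad_norm|exact: past_proxy].
by move=> w; exact: proxy_gt0.
Qed.

Lemma past_measurable t (H : Omega -> R) :
  measurable_fun setT (H : past g t -> R) -> measurable_fun setT H.
Proof.
move=> /measurable_pastP HG _ B mB; rewrite setTI.
by apply: (natural_filtration_measurable g_measurable); exact: HG.
Qed.

Lemma integrable_noise_pow t i : (1 <= t)%N ->
  P.-integrable setT (EFin \o (fun w => `|xi t w 0 i| `^ p)).
Proof.
move=> t1; have [Y [[iX _ _ _] _]] := heavy_tail i t1.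
by apply: eq_integrable iX => // w _ /=; rewrite noiseE.
Qed.

Lemma integrable_noise_moment t : (1 <= t)%N -> P.-integrable setT (EFin \o W t).
Proof. by move=> t1; apply: integrable_real_sum => i _; exact: integrable_noise_pow. Qed.

(** The conditional moment bounds, summed over the coordinates and tested
    against a random variable of the past. *)
Lemma expectation_mul_noise_moment t (H : Omega -> R) : (1 <= t)%N ->
  measurable_fun setT (H : past g t.-1 -> R) -> (forall w, 0 <= H w <= 1) ->
  \int[P]_w (H w * W t w) <= (\sum_i sigma 0 i `^ p) * \int[P]_w H w.
Proof.
move=> t1 mH H01; have H1 w : `|H w| <= 1.
  by have /andP[h0 h1] := H01 w; rewrite ger0_norm.
have -> : \int[P]_w (H w * W t w) = \int[P]_w (\sum_i H w * `|xi t w 0 i| `^ p).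
  by apply: eq_Rintegral => w _; rewrite /noise_moment mulr_sumr.
rewrite Rintegral_sum => [|i _]; last first.
  exact: (integrable_bounded_mul (past_measurable mH) H1 (integrable_noise_pow i t1)).
rewrite mulr_suml; apply: ler_sum => i _.
have := cond_expectation_le_bounded_mul (@natural_filtration_measurable _ _ _ _ g g_measurable t.-1)
  (heavy_tail i t1) ((measurable_pastP _ _ _).1 mH) H01.
by under eq_Rintegral do rewrite -noiseE.
Qed.

Lemma expectation_noise_moment t : (1 <= t)%N ->
  \int[P]_w W t w <= \sum_i sigma 0 i `^ p.
Proof.
move=> t1.
have m1 : measurable_fun setT ((fun=> 1) : past g t.-1 -> R) by exact: measurable_cst.
have h01 (w : Omega) : 0 <= (1 : R) <= 1 by rewrite ler01 lexx.
have := expectation_mul_noise_moment t1 m1 h01.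
rewrite Rintegral_probability_cst mulr1; apply: le_trans.
rewrite le_eqVlt; apply/orP; left; apply/eqP.
by apply: eq_Rintegral => w _; rewrite mul1r.
Qed.

Lemma integrable_noise t i : (1 <= t)%N ->
  P.-integrable setT (EFin \o (fun w => xi t w 0 i)).
Proof.
move=> t1; have [iX iY _ _] := unbiased i t1.
by apply: eq_integrable (integrable_real_B iX iY) => // w _ /=; rewrite noiseE.
Qed.

Definition direction t i w := partial_deriv f i (x t w) / beta t w.

Lemma past_direction t i : (1 <= t)%N ->
  measurable_fun setT (direction t i : past g t.-1 -> R).
Proof.
move=> t1; apply: measurable_fun_div; [|exact: past_partial_deriv|exact: past_proxy].
by move=> w; exact: proxy_gt0.
Qed.

Lemma direction_le1 t i w : `|direction t i w| <= 1.
Proof.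
have b0 : 0 < beta t w by exact: proxy_gt0.
rewrite /direction normrM normfV (gtr0_norm b0) ler_pdivrMr// mul1r.
have := coord_le_l2norm (gradient f (x t w)) i; rewrite mxE => /le_trans; apply.
apply: le_trans (grad_le_proxy f lambda0 adagrad tau0 t w).
by rewrite /grad_norm lerDl ltW.
Qed.

Lemma driftE t w : drift t w = \sum_i direction t i w * xi t w 0 i.
Proof.
rewrite /drift /dot mulr_suml; apply: eq_bigr => i _.
by rewrite mxE mulrAC.
Qed.

Lemma integrable_direction_noise t i : (1 <= t)%N ->
  P.-integrable setT (EFin \o (fun w => direction t i w * xi t w 0 i)).
Proof.
move=> t1; apply: integrable_bounded_mul (direction_le1 t i) (integrable_noise i t1).
exact: past_measurable (past_direction i t1).
Qed.

Lemma integrable_drift t : (1 <= t)%N -> P.-integrable setT (EFin \o drift t).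
Proof.
move=> t1; rewrite (_ : drift t = fun w => \sum_i direction t i w * xi t w 0 i).
  by apply: integrable_real_sum => i _; exact: integrable_direction_noise.
by apply/funext => w; exact: driftE.
Qed.

(** grad_t / beta_t has coordinates in [-1, 1] determined by the past, and the
    noise is conditionally centred. *)
Lemma expectation_drift t : (1 <= t)%N -> \int[P]_w drift t w = 0.
Proof.
move=> t1; under eq_Rintegral do rewrite driftE.
rewrite Rintegral_sum => [|i _]; last exact: integrable_direction_noise.
apply: big1 => i _; have [iX iY _ _] := unbiased i t1.
have md := past_measurable (past_direction i t1).
have d1 := direction_le1 t i.
under eq_Rintegral do rewrite noiseE mulrBr.
rewrite RintegralB//; [|exact: integrable_bounded_mul md d1 iX
                       |exact: integrable_bounded_mul md d1 iY].
apply/eqP; rewrite subr_eq0; apply/eqP.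
apply: (cond_expectation_bounded_mul (@natural_filtration_measurable _ _ _ _ g g_measurable t.-1) (unbiased i t1)) => //.
by apply/measurable_pastP; exact: past_direction.
Qed.

Lemma ratio_01 t w : 0 <= ratio t w <= 1.
Proof. exact: ratio01. Qed.

Lemma ratio_norm t w : `|ratio t w| <= 1.
Proof. by have /andP[r0 r1] := ratio_01 t w; rewrite ger0_norm. Qed.

Lemma ratio_sqr_01 t w : 0 <= ratio t w ^+ 2 <= 1.
Proof. by have /andP[r0 r1] := ratio_01 t w; rewrite sqr_ge0 exprn_ile1. Qed.

Lemma ratio_sqr_norm t w : `|ratio t w ^+ 2| <= 1.
Proof. by have /andP[r0 r1] := ratio_sqr_01 t w; rewrite ger0_norm. Qed.

Lemma integrable_grad_norm t : (1 <= t)%N -> P.-integrable setT (EFin \o nrm t).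
Proof.
move=> t1; apply: (@integrable_bounded _ _ _ _ _ (gbound t)) => [|w].
  exact: past_measurable (past_grad_norm t1).
rewrite ger0_norm ?l2norm_ge0//.
by apply: (grad_norm_le smooth gamma0 lambda0 adagrad); rewrite t1 leqnn.
Qed.

Lemma integrable_energy t : (1 <= t)%N -> P.-integrable setT (EFin \o energy t).
Proof.
move=> t1; rewrite (_ : energy t = fun w => ratio t w * nrm t w).
  apply: integrable_bounded_mul (ratio_norm t) (integrable_grad_norm t1).
  exact: past_measurable (past_ratio t1).
by apply/funext => w; exact: energyE.
Qed.

(** The conditions on M say that the truncated noise has second moment at most
    tau^2 and that its tail has first moment at most tau r.  Together the two
    error terms cost 1/4 of the energy and 2 tau r^2, from
    r a <= a^2 / 8 + 2 r^2 with a = n_t / beta_t. *)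
Lemma expected_step t (sp M r c : R) : (1 <= t)%N ->
  0 < M -> 0 <= r -> 0 <= c ->
  \sum_i sigma 0 i `^ p <= sp ->
  sp * M `^ (2 - p) <= tau ^+ 2 -> sp * M `^ (1 - p) <= tau * r ->
  let F w := 7 / 8 * energy t w + drift t w - c * W t w
     - M `^ (2 - p) / (8 * tau) * (ratio t w ^+ 2 * W t w)
     - M `^ (1 - p) * (ratio t w * W t w) in
  P.-integrable setT (EFin \o F) /\
  5 / 8 * \int[P]_w energy t w - c * sp - 2 * tau * r ^+ 2 <= \int[P]_w F w.
Proof.
move=> t1 M0 r0 c0 ssp spM2 spM1 F.
have iW := integrable_noise_moment t1.
have iE := integrable_energy t1.
have iU := integrable_drift t1.
have pr := past_ratio t1.
have pr2 : measurable_fun setT ((fun w => ratio t w ^+ 2) : past g t.-1 -> R).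
  exact: measurable_funX.
have mr := past_measurable pr; have mr2 := past_measurable pr2.
have ir := integrable_bounded P mr (ratio_norm t).
have ir2 := integrable_bounded P mr2 (ratio_sqr_norm t).
have irW := integrable_bounded_mul mr (ratio_norm t) iW.
have ir2W := integrable_bounded_mul mr2 (ratio_sqr_norm t) iW.
have i1 := integrable_real_Z (7 / 8) iE.
have i2 := integrable_real_D i1 iU.
have i3 := integrable_real_Z c iW.
have i4 := integrable_real_B i2 i3.
have i5 := integrable_real_Z (M `^ (2 - p) / (8 * tau)) ir2W.
have i6 := integrable_real_B i4 i5.
have i7 := integrable_real_Z (M `^ (1 - p)) irW.
split; first exact: integrable_real_B i6 i7.
rewrite /F RintegralB// RintegralB// RintegralB// RintegralD// !RintegralZl//.
rewrite expectation_drift// addr0.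
have EW : \int[P]_w W t w <= sp.
  exact: le_trans (expectation_noise_moment t1) ssp.
have ErW : \int[P]_w (ratio t w * W t w) <= sp * \int[P]_w ratio t w.
  apply: le_trans (expectation_mul_noise_moment t1 pr (ratio_01 t)) _.
  rewrite ler_wpM2r//; apply: Rintegral_ge0 => w _.
  by have /andP[] := ratio_01 t w.
have Er2W : \int[P]_w (ratio t w ^+ 2 * W t w) <= sp * \int[P]_w (ratio t w ^+ 2).
  apply: le_trans (expectation_mul_noise_moment t1 pr2 (ratio_sqr_01 t)) _.
  by rewrite ler_wpM2r//; apply: Rintegral_ge0 => w _; exact: sqr_ge0.
have Er0 : 0 <= \int[P]_w ratio t w.
  by apply: Rintegral_ge0 => w _; have /andP[] := ratio_01 t w.
have Er20 : 0 <= \int[P]_w (ratio t w ^+ 2).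
  by apply: Rintegral_ge0 => w _; exact: sqr_ge0.
have Er2E : tau * \int[P]_w (ratio t w ^+ 2) <= \int[P]_w energy t w.
  rewrite -RintegralZl//; apply: le_Rintegral => //; first exact: integrable_real_Z.
  by move=> w _; rewrite mulrC; apply: ratio_sqr_le_energy.
have ErE : r * \int[P]_w ratio t w <= 8^-1 * \int[P]_w (ratio t w ^+ 2) + 2 * r ^+ 2.
  rewrite -[X in _ + X](Rintegral_probability_cst P) -!RintegralZl// -RintegralD//; last 2 first.
  - exact: integrable_real_Z.
  - exact: integrable_real_cst.
  apply: le_Rintegral => //; first exact: integrable_real_Z.
    by apply: integrable_real_D; [exact: integrable_real_Z|exact: integrable_real_cst].
  by move=> w _; have := sqr_ge0 (ratio t w - 4 * r); lra.
have A1 : M `^ (2 - p) / (8 * tau) * \int[P]_w (ratio t w ^+ 2 * W t w)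
    <= 8^-1 * \int[P]_w energy t w.
  apply: (@le_trans _ _ (M `^ (2 - p) / (8 * tau) * (sp * \int[P]_w (ratio t w ^+ 2)))).
    by rewrite ler_wpM2l// divr_ge0 ?powR_ge0// mulr_ge0// ltW.
  apply: (@le_trans _ _ (tau ^+ 2 / (8 * tau) * \int[P]_w (ratio t w ^+ 2))).
    rewrite mulrA ler_wpM2r// mulrAC ler_wpM2r ?invr_ge0 ?mulr_ge0 ?(ltW tau0)//.
    by rewrite mulrC.
  have -> : tau ^+ 2 / (8 * tau) * \int[P]_w (ratio t w ^+ 2)
     = 8^-1 * (tau * \int[P]_w (ratio t w ^+ 2)) by field; rewrite gt_eqF.
  by rewrite ler_wpM2l.
have A2 : M `^ (1 - p) * \int[P]_w (ratio t w * W t w)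
    <= 8^-1 * \int[P]_w energy t w + 2 * tau * r ^+ 2.
  apply: (@le_trans _ _ (M `^ (1 - p) * (sp * \int[P]_w ratio t w))).
    by rewrite ler_wpM2l// powR_ge0.
  apply: (@le_trans _ _ (tau * r * \int[P]_w ratio t w)).
    by rewrite mulrA ler_wpM2r// mulrC.
  by have := ler_wpM2l (ltW tau0) ErE; lra.
by have := ler_wpM2l c0 EW; lra.
Qed.

(** Integrating the pathwise inequality; the condition on m says that m
    bounds the size of the total noise. *)
Lemma expected_energy_sum T (K m M r sp : R) : 0 < K -> 0 < m -> 0 < M -> 0 <= r ->
  \sum_i sigma 0 i `^ p <= sp ->
  sp * M `^ (2 - p) <= tau ^+ 2 -> sp * M `^ (1 - p) <= tau * r ->
  T%:R * sp * m `^ (1 - p) <= m ->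
  5 / 8 * \sum_(1 <= t < T.+1) \int[P]_w energy t w
  <= (f x1 - inf (range f)) / gamma + (gamma * linfnorm L / 2 + 4 * tau)
     * (2 * (ln K - 1)
        + 2 * (lambda + 2 * (Num.sqrt T%:R * gbound T) + 4 * m) / (lambda * K))
     + 2 * tau * (T%:R * r ^+ 2).
Proof.
move=> K0 m0 M0 r0 ssp spM2 spM1 mT.
set LQ := gamma * linfnorm L / 2 + 4 * tau.
have LQ0 : 0 <= LQ.
  by rewrite /LQ addr_ge0 ?mulr_ge0 ?linfnorm_ge0 ?(ltW gamma0) ?(ltW tau0).
have lK0 : 0 < lambda * K by rewrite mulr_gt0.
pose c := LQ * (4 * m `^ (1 - p) / (lambda * K)).
have c0 : 0 <= c by rewrite mulr_ge0// divr_ge0 ?mulr_ge0 ?powR_ge0// ltW.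
pose F t w := 7 / 8 * energy t w + drift t w - c * W t w
     - M `^ (2 - p) / (8 * tau) * (ratio t w ^+ 2 * W t w)
     - M `^ (1 - p) * (ratio t w * W t w).
have iF t : t \in index_iota 1 T.+1 -> P.-integrable setT (EFin \o F t).
  by rewrite mem_index_iota => /andP[t1 _]; have [] := expected_step t1 M0 r0 c0 ssp spM2 spM1.
have up : \int[P]_w (\sum_(1 <= t < T.+1) F t w)
  <= (f x1 - inf (range f)) / gamma + LQ
     * (2 * (ln K - 1)
        + 2 * (lambda + 2 * (Num.sqrt T%:R * gbound T) + 2 * m) / (lambda * K)).
  rewrite -[leRHS](Rintegral_probability_cst P).
  apply: le_Rintegral => //; [exact: integrable_real_sum|exact: integrable_real_cst|].
  by move=> w _; apply: energy_sum_le.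
have low : 5 / 8 * (\sum_(1 <= t < T.+1) \int[P]_w energy t w)
    - T%:R * (c * sp + 2 * tau * r ^+ 2) <= \int[P]_w (\sum_(1 <= t < T.+1) F t w).
  rewrite Rintegral_sum//.
  have -> : T%:R * (c * sp + 2 * tau * r ^+ 2)
      = \sum_(1 <= t < T.+1) (c * sp + 2 * tau * r ^+ 2).
    by rewrite sumr_const_nat subSS subn0 mulr_natl.
  rewrite mulr_sumr -sumrB big_seq [leRHS]big_seq; apply: ler_sum => t.
  rewrite mem_index_iota => /andP[t1 _].
  by have [_] := expected_step t1 M0 r0 c0 ssp spM2 spM1; rewrite /F; lra.
have cT : T%:R * (c * sp) <= LQ * (4 * m / (lambda * K)).
  have -> : T%:R * (c * sp) = LQ * (4 * (T%:R * sp * m `^ (1 - p)) / (lambda * K)).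
    by rewrite /c; ring.
  by rewrite ler_wpM2l// ler_pM2r ?invr_gt0// ler_pM2l.
have -> : 2 * (lambda + 2 * (Num.sqrt T%:R * gbound T) + 4 * m) / (lambda * K)
  = 2 * (lambda + 2 * (Num.sqrt T%:R * gbound T) + 2 * m) / (lambda * K)
    + 4 * m / (lambda * K) by field; rewrite !gt_eqF.
by lra.
Qed.

Lemma expected_grad_norm_sum T (kappa m sp : R) : 3 <= kappa -> 0 < m ->
  \sum_i sigma 0 i `^ p <= sp -> T%:R * sp * m `^ (1 - p) <= m ->
  \int[P]_w (\sum_(1 <= t < T.+1) nrm t w)
  <= Num.sqrt T%:R * (kappa * \sum_(1 <= t < T.+1) \int[P]_w energy t w
                      + (lambda + tau + 4 * m) / kappa).
Proof.
move=> k3 m0 ssp mT.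
have k0 : 0 < kappa by rewrite (lt_le_trans _ k3).
have iE t : t \in index_iota 1 T.+1 -> P.-integrable setT (EFin \o energy t).
  by rewrite mem_index_iota => /andP[t1 _]; exact: integrable_energy.
have iN t : t \in index_iota 1 T.+1 -> P.-integrable setT (EFin \o nrm t).
  by rewrite mem_index_iota => /andP[t1 _]; exact: integrable_grad_norm.
have iW t : t \in index_iota 1 T.+1 -> P.-integrable setT (EFin \o W t).
  by rewrite mem_index_iota => /andP[t1 _]; exact: integrable_noise_moment.
have iSE := integrable_real_sum iE; have iSN := integrable_real_sum iN.
have iSW := integrable_real_sum iW.
pose c := 2 * m `^ (1 - p) / kappa.
have c0 : 0 <= c by rewrite divr_ge0 ?mulr_ge0 ?powR_ge0// ltW.
have EW t : (1 <= t)%N -> \int[P]_w W t w <= sp.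
  by move=> t1; exact: le_trans (expectation_noise_moment t1) ssp.
have ESW : \int[P]_w (\sum_(1 <= t < T.+1) W t w) <= T%:R * sp.
  rewrite Rintegral_sum//.
  have -> : T%:R * sp = \sum_(1 <= t < T.+1) sp.
    by rewrite sumr_const_nat subSS subn0 mulr_natl.
  rewrite big_seq [leRHS]big_seq; apply: ler_sum => t.
  by rewrite mem_index_iota => /andP[t1 _]; exact: EW.
have i1 := integrable_real_Z kappa iSE.
have i2 := integrable_real_Z c iSW.
have i3 := integrable_real_cst P ((lambda + tau + 2 * m) / kappa).
apply: (@le_trans _ _ (\int[P]_w (Num.sqrt T%:R * (kappa * (\sum_(1 <= t < T.+1) energy t w)
    + c * (\sum_(1 <= t < T.+1) W t w) + (lambda + tau + 2 * m) / kappa)))).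
  apply: le_Rintegral => //.
    by apply: integrable_real_Z; apply: integrable_real_D => //; exact: integrable_real_D.
  move=> w _; apply: le_trans (sum_le_sqrt _ _) _.
  rewrite ler_wpM2l ?sqrtr_ge0//.
  apply: le_trans (sum_sqr_grad_norm_le f lambda0 adagrad T w (ltW tau0) k3) _.
  rewrite -[leRHS]addrA lerD2l /c [2 * _ / kappa * _]mulrAC -mulrDl ler_pM2r ?invr_gt0//.
  by have := total_noise_le f p12 g x T w m0; lra.
rewrite RintegralZl//; last by apply: integrable_real_D => //; exact: integrable_real_D.
rewrite ler_wpM2l ?sqrtr_ge0// RintegralD//; last exact: integrable_real_D.
rewrite RintegralD// Rintegral_probability_cst !RintegralZl// -addrA [\int[P]_w (\sum_(1 <= t < T.+1) energy t w)]Rintegral_sum//.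
rewrite lerD2l.
have -> : (lambda + tau + 4 * m) / kappa = 2 * m / kappa + (lambda + tau + 2 * m) / kappa.
  by field; rewrite gt_eqF.
rewrite lerD2r (le_trans (ler_wpM2l c0 ESW))// /c mulrAC ler_pM2r ?invr_gt0//.
by rewrite -mulrA ler_pM2l// mulrC.
Qed.

End expected.

(** * Choice of the parameters *)

Section constants.
Context {R : realType}.
Implicit Types (lambda A N m l t s p : R).

Lemma powR_div t l e : 0 <= t -> 0 <= l -> (t / l) `^ e = t `^ e * l `^ (- e).
Proof.
move=> t0 l0; rewrite powRM ?invr_ge0//; congr (_ * _).
by rewrite -(powR_inv1 l0) -powRrM mulN1r.
Qed.

(** With D = A + N and H = lambda + 5 m, the weight kappa is close to
    sqrt (H / D), which gives kappa D and H / kappa of order D + sqrt (H D).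
    The summand 3 keeps kappa admissible. *)
Lemma balance_kappa lambda A N m : 0 < lambda -> 0 < A -> 0 <= N -> 0 <= m ->
  exists2 kappa, 3 <= kappa &
  kappa * (132 * (A + N)) + (lambda + 5 * m) / kappa
    <= 600 * (lambda + A + N + Num.sqrt (A * m) + Num.sqrt (N * m)).
Proof.
move=> l0 A0 N0 m0.
set D := A + N; set H := lambda + 5 * m.
have D0 : 0 < D by rewrite ltr_pwDl.
have H0 : 0 < H by rewrite ltr_pwDl// mulr_ge0.
set k := Num.sqrt (H / D).
have k0 : 0 < k by rewrite sqrtr_gt0 divr_gt0.
have kD : k * D = Num.sqrt (H * D).
  rewrite -[D in LHS](gtr0_norm D0) -sqrtr_sqr -sqrtrM ?divr_ge0 ?(ltW H0) ?(ltW D0)//.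
  by congr Num.sqrt; field; rewrite gt_eqF.
have Hk : H / (3 + k) <= k * D.
  have kk : k * k * D = H by rewrite -expr2 sqr_sqrtr ?divr_ge0 ?(ltW H0) ?(ltW D0)// divfK// gt_eqF.
  rewrite ler_pdivrMr; last by rewrite addr_gt0.
  have : 0 <= 3 * (k * D) by rewrite !mulr_ge0// ltW.
  by rewrite -kk; lra.
have HD : Num.sqrt (H * D) <= lambda + A + N + 3 * Num.sqrt (A * m) + 3 * Num.sqrt (N * m).
  have a0 := sqrtr_ge0 (A * m); have b0 := sqrtr_ge0 (N * m).
  have a2 : Num.sqrt (A * m) ^+ 2 = A * m by rewrite sqr_sqrtr// mulr_ge0// ltW.
  have b2 : Num.sqrt (N * m) ^+ 2 = N * m by rewrite sqr_sqrtr// mulr_ge0.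
  have R0 : 0 <= lambda + A + N + 3 * Num.sqrt (A * m) + 3 * Num.sqrt (N * m).
    by rewrite !addr_ge0 ?mulr_ge0 ?(ltW l0) ?(ltW A0).
  rewrite -(ger0_norm R0) -sqrtr_sqr ler_sqrt ?sqr_ge0// /H /D.
  move: (Num.sqrt (A * m)) (Num.sqrt (N * m)) a0 b0 a2 b2 => a b a0 b0 a2 b2.
  have -> : (lambda + 5 * m) * (A + N)
    = lambda * A + lambda * N + 5 * (A * m) + 5 * (N * m) by ring.
  have h1 : 0 <= lambda * A by rewrite mulr_ge0 ?ltW.
  have h2 : 0 <= lambda * N by rewrite mulr_ge0 ?(ltW l0).
  have h3 : 0 <= (A + N) * (a + b) by rewrite mulr_ge0 ?addr_ge0// ltW.
  have h4 : 0 <= lambda * (a + b) by rewrite mulr_ge0 ?addr_ge0// ltW.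
  have h5 : 0 <= a * b by rewrite mulr_ge0.
  rewrite -a2 -b2.
  have -> : (lambda + A + N + 3 * a + 3 * b) ^+ 2 = lambda ^+ 2 + (A + N) ^+ 2
    + 9 * a ^+ 2 + 9 * b ^+ 2 + 2 * (lambda * A) + 2 * (lambda * N) + 6 * ((A + N) * (a + b))
    + 6 * (lambda * (a + b)) + 18 * (a * b) by ring.
  have := sqr_ge0 lambda; have := sqr_ge0 (A + N); have := sqr_ge0 a; have := sqr_ge0 b.
  lra.
exists (3 + k); first by rewrite lerDl ltW.
have := sqrtr_ge0 (A * m); have := sqrtr_ge0 (N * m).
rewrite -kD in HD.
have -> : (3 + k) * (132 * D) = 396 * D + 132 * (k * D) by ring.
rewrite /D in HD Hk *; lra.
Qed.

Variables (t l s p : R).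
Hypotheses (t0 : 0 < t) (l0 : 0 < l) (s0 : 0 < s) (p1 : 1 < p).

(** The level at which truncated second moment and truncated tail are balanced. *)
Definition truncation_level := s * (t / l) `^ p^-1.
(** Equal to s (t / l)^(1/p - 1/2); bounds the root mean square of the noise
    truncated at that level. *)
Definition effective_noise := truncation_level * Num.sqrt (l / t).

Let M := truncation_level.
Let tau := effective_noise.
Let m := s * t `^ p^-1.

Lemma truncation_level_gt0 : 0 < truncation_level.
Proof. by rewrite mulr_gt0// powR_gt0// divr_gt0. Qed.

Lemma effective_noise_gt0 : 0 < effective_noise.
Proof. by rewrite mulr_gt0 ?truncation_level_gt0// sqrtr_gt0 divr_gt0. Qed.

Lemma powR_scale_root (u : R) : 0 < u -> (s * u `^ p^-1) `^ p = s `^ p * u.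
Proof.
move=> u0; rewrite powRM ?powR_ge0 ?(ltW s0)//; congr (_ * _).
by rewrite -powRrM mulVf ?powRr1 ?(ltW u0)// gt_eqF// (lt_trans ltr01).
Qed.

Lemma powR_sub_mul (a b u : R) : 0 < u -> u `^ (a - b) = u `^ a / u `^ b.
Proof. by move=> u0; rewrite powRB ?(gt_eqF u0) ?implybT. Qed.

Lemma truncation_levelM2 : s `^ p * M `^ (2 - p) = tau ^+ 2.
Proof.
have M0 := truncation_level_gt0; have sp0 : 0 < s `^ p by rewrite powR_gt0.
rewrite powR_sub_mul// powR_scale_root ?divr_gt0// powR_mulrn ?(ltW M0)//.
rewrite /tau /effective_noise [in RHS]exprMn sqr_sqrtr ?divr_ge0 ?(ltW l0) ?(ltW t0)// -/M.
by field; rewrite !gt_eqF.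
Qed.

Lemma truncation_levelM1 : s `^ p * M `^ (1 - p) = tau * Num.sqrt (l / t).
Proof.
have M0 := truncation_level_gt0; have sp0 : 0 < s `^ p by rewrite powR_gt0.
rewrite powR_sub_mul// powR_scale_root ?divr_gt0// powRr1 ?(ltW M0)//.
rewrite /tau /effective_noise -mulrA -expr2 sqr_sqrtr ?divr_ge0 ?(ltW l0) ?(ltW t0)// -/M.
by field; rewrite !gt_eqF.
Qed.

Lemma total_noise_balance : t * s `^ p * m `^ (1 - p) = m.
Proof.
have m0 : 0 < m by rewrite mulr_gt0// powR_gt0.
have sp0 : 0 < s `^ p by rewrite powR_gt0.
rewrite powR_sub_mul// powR_scale_root// powRr1 ?(ltW m0)//.
by field; rewrite !gt_eqF.
Qed.

Lemma effective_noiseE : tau = s * t `^ (p^-1 - 2^-1) * l `^ (2^-1 - p^-1).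
Proof.
rewrite /tau /effective_noise /truncation_level -powR12_sqrt ?divr_ge0 ?ltW//.
rewrite !powR_div ?ltW// !powR_sub_mul// !powRN.
by field; rewrite !gt_eqF ?powR_gt0.
Qed.

(** The exponent 1/p - 1/2 of T / l is nonnegative and at most 1/p. *)
Lemma effective_noise_le : p <= 2 -> 1 <= l -> 1 <= t -> tau <= m.
Proof.
move=> p2 l1 t1; rewrite effective_noiseE -mulrA ler_pM2l//.
have pp : 2^-1 <= p^-1 by rewrite lef_pV2 ?posrE// (lt_trans ltr01).
apply: (@le_trans _ _ (t `^ (p^-1 - 2^-1))).
  by rewrite ler_piMr ?powR_ge0// -[leRHS](powRr0 l) ler_powR// subr_le0.
by rewrite ler_powR// gerBl.
Qed.

End constants.

(** * Assembling the rate *)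

Section rate.
Context {disp : measure_display} {Omega : measurableType disp}.
Context {R : realType} {d : nat}.
Variables (f : 'rV[R]_d -> R) (L sigma : 'rV[R]_d) (p : R).
Variable P : probability Omega R.
Hypothesis f_lb : has_lbound (range f).
Hypothesis L_gt0 : 0 < linfnorm L.
Hypothesis smooth : forall y z,
  `|f y - f z - dot (gradient f z) (y - z)| <= 2^-1 * weighted_norm2 L (y - z).
Hypothesis p12 : 1 < p <= 2.
Variables (gamma lambda : R) (x1 : 'rV[R]_d) (g : nat -> Omega -> 'rV[R]_d)
  (v : nat -> Omega -> R) (x : nat -> Omega -> 'rV[R]_d).
Hypotheses (gamma0 : 0 < gamma) (lambda0 : 0 < lambda).
Hypothesis g_measurable : forall t, (1 <= t)%N -> random_vector (g t).
Hypothesis adagrad : adagrad_norm gamma lambda x1 g v x.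
Hypothesis unbiased : forall t i, (1 <= t)%N ->
  is_cond_expectation P (natural_filtration g t.-1)
    (fun w => g t w 0 i) (fun w => partial_deriv f i (x t w)).
Hypothesis heavy_tail : forall t i, (1 <= t)%N ->
  cond_expectation_le P (natural_filtration g t.-1)
    (fun w => `|g t w 0 i - partial_deriv f i (x t w)| `^ p) (sigma 0 i `^ p).
Variables (T : nat) (K : R).
Hypothesis T0 : (0 < T)%N.

Local Notation nrm := (grad_norm f x).
Local Notation l := (ln K).
Local Notation Delta := (f x1 - inf (range f)).
Local Notation A := (Delta / gamma + gamma * linfnorm L * l).

Lemma gap_ge0 : 0 <= Delta.
Proof. by rewrite subr_ge0; apply: ge_inf => //; exists x1. Qed.

(** The hypothesis on K - 1 says that K exceeds 1 by the sizes of the noise and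
    of the gradients relative to lambda; this is what bounds the expected
    logarithm by a multiple of l. *)
Lemma expected_sum_le s N m :
  N = effective_noise T%:R l s p * l -> m = s * T%:R `^ p^-1 ->
  0 < K -> 1 <= l -> 0 < s ->
  \sum_i sigma 0 i `^ p <= s `^ p ->
  m + l2norm (gradient f x1) * Num.sqrt T%:R
     + gamma * linfnorm L * (T%:R * Num.sqrt T%:R) <= lambda * (K - 1) ->
  \int[P]_w (\sum_(1 <= t < T.+1) nrm t w)
  <= Num.sqrt T%:R * (600 * (lambda + A + N + Num.sqrt (A * m) + Num.sqrt (N * m))).
Proof.
move=> NE mE K0 l1 s0 ssp budget.
have /andP[p1 p2] := p12.
have T0' : 0 < T%:R :> R by rewrite ltr0n.
have T1 : 1 <= T%:R :> R by rewrite ler1n.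
have l0 : 0 < l by rewrite (lt_le_trans ltr01).
pose tau := effective_noise T%:R l s p.
rewrite -/tau in NE.
have tau0 : 0 < tau by exact: effective_noise_gt0.
pose M := truncation_level T%:R l s p.
have M0 : 0 < M by exact: truncation_level_gt0.
have m0 : 0 < m by rewrite mE mulr_gt0// powR_gt0.
have r0 : 0 <= Num.sqrt (l / T%:R) := sqrtr_ge0 _.
have N0 : 0 < N by rewrite NE mulr_gt0.
have A0 : 0 < A.
  rewrite ltr_wpDl ?mulr_gt0// divr_ge0 ?gap_ge0// ltW//.
have spM2 : s `^ p * M `^ (2 - p) <= tau ^+ 2 by rewrite truncation_levelM2.
have spM1 : s `^ p * M `^ (1 - p) <= tau * Num.sqrt (l / T%:R).
  by rewrite truncation_levelM1.
have mT : T%:R * s `^ p * m `^ (1 - p) <= m by rewrite mE total_noise_balance.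
have taum : tau <= m by rewrite mE; exact: effective_noise_le.
clearbody tau M.
have energy_le : \sum_(1 <= t < T.+1) \int[P]_w energy f lambda v x tau t w <= 132 * (A + N).
  have := expected_energy_sum f_lb smooth p12 gamma0 lambda0 g_measurable adagrad
    unbiased heavy_tail tau0 K0 m0 M0 r0 ssp spM2 spM1 mT.
  set S := \sum_(1 <= t < T.+1) _.
  have -> : T%:R * Num.sqrt (l / T%:R) ^+ 2 = l.
    rewrite sqr_sqrtr; last by rewrite divr_ge0// ltW.
    by rewrite mulrC divfK// gt_eqF.
  have frac : 2 * (lambda + 2 * (Num.sqrt T%:R * grad_bound f L gamma x1 T) + 4 * m)
      / (lambda * K) <= 20.
    rewrite ler_pdivrMr ?mulr_gt0//.
    have g0 : 0 <= l2norm (gradient f x1) * Num.sqrt T%:R.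
      by rewrite mulr_ge0 ?l2norm_ge0.
    have -> : Num.sqrt T%:R * grad_bound f L gamma x1 T
      = l2norm (gradient f x1) * Num.sqrt T%:R
        + 3 * (gamma * linfnorm L * (T%:R * Num.sqrt T%:R)) by rewrite /grad_bound; ring.
    have X0 : 0 <= gamma * linfnorm L * (T%:R * Num.sqrt T%:R).
      by rewrite mulr_ge0 ?mulr_ge0 ?ler0n ?sqrtr_ge0 // ltW.
    have lK0 : 0 < lambda * K by rewrite mulr_gt0.
    by move: (ltW m0) g0 X0 lK0 budget lambda0; lra.
  have LQ0 : 0 <= gamma * linfnorm L / 2 + 4 * tau.
    by rewrite addr_ge0 ?mulr_ge0 ?(ltW L_gt0) ?(ltW gamma0) ?(ltW tau0).
  have h : 2 * (l - 1) + 2 * (lambda + 2 * (Num.sqrt T%:R * grad_bound f L gamma x1 T)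
      + 4 * m) / (lambda * K) <= 20 * l by move: frac l1; lra.
  have := ler_wpM2l LQ0 h.
  have Dg : 0 <= Delta / gamma by rewrite divr_ge0 ?gap_ge0// ltW.
  have Ll : 0 <= gamma * linfnorm L * l by rewrite !mulr_ge0 ?ltW.
  have := ltW N0; rewrite NE; move: Dg Ll; lra.
have [kappa k3 balance] := balance_kappa lambda0 A0 (ltW N0) (ltW m0).
have k0 : 0 < kappa by rewrite (lt_le_trans _ k3).
apply: le_trans (expected_grad_norm_sum smooth p12 gamma0 lambda0 g_measurable adagrad
    unbiased heavy_tail tau0 k3 m0 ssp mT) _.
rewrite ler_wpM2l ?sqrtr_ge0//; apply: le_trans balance.
by rewrite lerD// ?ler_pM2l// ler_pM2r ?invr_gt0//; lra.
Qed.

End rate.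

Section exponents.
Context {R : realType}.
Variables (t l s p : R).
Hypotheses (t0 : 0 < t) (l0 : 0 < l) (s0 : 0 < s) (p1 : 1 < p).

Let p_neq0 : p != 0. Proof. by rewrite gt_eqF// (lt_trans ltr01). Qed.
Let pB1_neq0 : p - 1 != 0. Proof. by rewrite gt_eqF// subr_gt0. Qed.

Lemma rate_noise : effective_noise t l s p * l / Num.sqrt t
  = s * l `^ ((p / (p - 1))^-1 + 2^-1) / t `^ ((p - 1) / p).
Proof.
rewrite effective_noiseE// -[Num.sqrt t]powR12_sqrt ?ltW//.
rewrite -{2}(powRr1 (ltW l0)).
have -> : (p / (p - 1))^-1 + 2^-1 = (2^-1 - p^-1) + 1.
  by field; rewrite p_neq0 pB1_neq0.
have -> : (p - 1) / p = 2^-1 - (p^-1 - 2^-1) by field.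
rewrite !powR_sub_mul// !(powRD (s := 1)) ?(gt_eqF l0) ?implybT// !powR_sub_mul//.
by field; rewrite !gt_eqF ?powR_gt0.
Qed.

Lemma rate_cross A : 0 <= A -> Num.sqrt (A * (s * t `^ p^-1)) / Num.sqrt t
  = Num.sqrt (A * s) / t `^ ((p - 1) / (2 * p)).
Proof.
move=> A0; rewrite mulrA sqrtrM ?mulr_ge0 ?(ltW s0)//.
rewrite -(powR12_sqrt (ltW t0)) -(powR12_sqrt (powR_ge0 t p^-1)) -powRrM.
have -> : (p - 1) / (2 * p) = 2^-1 - p^-1 * 2^-1 by field.
rewrite powR_sub_mul//.
by field; rewrite !gt_eqF ?powR_gt0.
Qed.

Lemma rate_tail : Num.sqrt (effective_noise t l s p * l * (s * t `^ p^-1)) / Num.sqrt t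
  = s * l `^ ((2 * (p / (p - 1)))^-1 + 4^-1) / t `^ ((3 * p - 4) / (4 * p)).
Proof.
rewrite effective_noiseE//.
have -> : (2 * (p / (p - 1)))^-1 + 4^-1 = ((2^-1 - p^-1) + 1) * 2^-1.
  by field; rewrite p_neq0 pB1_neq0.
have -> : (3 * p - 4) / (4 * p) = 2^-1 - ((p^-1 - 2^-1) + p^-1) * 2^-1 by field.
have -> : s * t `^ (p^-1 - 2^-1) * l `^ (2^-1 - p^-1) * l * (s * t `^ p^-1)
   = s ^+ 2 * (t `^ ((p^-1 - 2^-1) + p^-1) * l `^ ((2^-1 - p^-1) + 1)).
  rewrite !powRD ?(gt_eqF l0) ?(gt_eqF t0) ?implybT// (powRr1 (ltW l0)); ring.
rewrite sqrtrM ?sqr_ge0// sqrtr_sqr (gtr0_norm s0) -[Num.sqrt t]powR12_sqrt ?ltW//.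
rewrite -powR12_sqrt ?mulr_ge0 ?powR_ge0// powRM ?powR_ge0// -!powRrM.
rewrite (powR_sub_mul 2^-1)//.
by field; rewrite !gt_eqF ?powR_gt0.
Qed.

End exponents.

Section closing.
Context {R : realType}.

Lemma lpnorm_powR {d : nat} (p : R) (sigma : 'rV[R]_d) : 1 < p ->
  (forall i, 0 <= sigma 0 i) -> lpnorm p sigma `^ p = \sum_i sigma 0 i `^ p.
Proof.
move=> p1 sigma0; have p0 : 0 < p by rewrite (lt_trans ltr01).
rewrite /lpnorm -powRrM mulVf ?gt_eqF// powRr1.
  by apply: eq_bigr => i _; rewrite ger0_norm.
by rewrite sumr_ge0// => i _; exact: powR_ge0.
Qed.

(** That is, e <= 4. *)
Lemma ln_ge1 (K : R) : 4 <= K -> 1 <= ln K.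
Proof.
move=> K4; have K0 : 0 < K by rewrite (lt_le_trans _ K4).
rewrite -(expRK 1) ler_ln ?posrE ?expR_gt0// (le_trans _ K4)//.
have h : 2^-1 <= expR (- 2^-1 : R).
  by rewrite (le_trans _ (expR_ge1Dx _))//; lra.
have -> : (1 : R) = 2^-1 + 2^-1 by lra.
rewrite expRD; move: h; rewrite expRN.
have := expR_gt0 (2^-1 : R); move: (expR _) => e e0 h.
have e2 : e <= 2 by rewrite -lef_pV2 ?posrE.
by have := ler_pM (ltW e0) (ltW e0) e2 e2; lra.
Qed.

Lemma expectation_Rintegral {disp} {Omega : measurableType disp}
    (P : probability Omega R) (X : Omega -> R) :
  P.-integrable setT (EFin \o X) -> ('E_P[X] = (\int[P]_w X w)%:E)%E.
Proof. by move=> iX; rewrite unlock /Rintegral fineK// integrable_fin_num. Qed.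

End closing.

Theorem theoremC1 (R : realType) :
  exists C : R, 0 < C /\
  forall (d : nat) (f : 'rV[R]_d -> R) (L sigma : 'rV[R]_d) (p : R)
    (disp : measure_display) (Omega : measurableType disp)
    (P : probability Omega R)
    (gamma lambda : R) (x1 : 'rV[R]_d)
    (g : nat -> Omega -> 'rV[R]_d)
    (v : nat -> Omega -> R) (x : nat -> Omega -> 'rV[R]_d)
    (T : nat),
  (0 < d)%N ->
  (forall y, differentiable f y) ->
  has_lbound (range f) ->
  (forall i, 0 < L 0 i) ->
  (forall y z, `|f y - f z - dot (gradient f z) (y - z)|
                 <= 2^-1 * weighted_norm2 L (y - z)) ->
  1 < p <= 2 ->
  (forall i, 0 <= sigma 0 i) ->
  0 < gamma ->
  0 < lambda ->
  (0 < T)%N ->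
  (forall t, (1 <= t)%N -> random_vector (g t)) ->
  adagrad_norm gamma lambda x1 g v x ->
  (forall t i, (1 <= t)%N ->
     is_cond_expectation P (natural_filtration g t.-1)
       (fun w => g t w 0 i) (fun w => partial_deriv f i (x t w))) ->
  (forall t i, (1 <= t)%N ->
     cond_expectation_le P (natural_filtration g t.-1)
       (fun w => `|g t w 0 i - partial_deriv f i (x t w)| `^ p)
       (sigma 0 i `^ p)) ->
  let pbar := p / (p - 1) in
  let Delta := f x1 - inf (range f) in
  let K := 1 + (Num.sqrt 2 * lpnorm p sigma * T%:R `^ p^-1
                + 2 * l2norm (gradient f x1) * T%:R `^ 2^-1
                + 2 * gamma * linfnorm L * T%:R `^ (3 / 2)) / lambda in
  ('E_P[(fun w => T%:R^-1 *
           \sum_(1 <= t < T.+1) l2norm (gradient f (x t w)))%R]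
   <= (C * ((lambda + Delta / gamma + gamma * linfnorm L * ln K)
              / Num.sqrt T%:R
            + lpnorm p sigma * ln K `^ (pbar^-1 + 2^-1)
              / T%:R `^ ((p - 1) / p)
            + Num.sqrt ((Delta / gamma + gamma * linfnorm L * ln K)
                        * lpnorm p sigma)
              / T%:R `^ ((p - 1) / (2 * p))
            + lpnorm p sigma * ln K `^ ((2 * pbar)^-1 + 4^-1)
              / T%:R `^ ((3 * p - 4) / (4 * p))))%R%:E)%E.
Proof.
exists 2400; split; first by rewrite ltr0n.
move=> d f L sigma p disp Omega P gamma lambda x1 g v x T d0 _ f_lb L0 smooth p12
  sigma0 gamma0 lambda0 T0 g_measurable adagrad unbiased heavy_tail; cbv zeta.
set pbar := p / (p - 1); set Delta := f x1 - inf (range f); set K := 1 + _ / lambda.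
have /andP[p1 p2] := p12.
have t0 : 0 < T%:R :> R by rewrite ltr0n.
have t1 : 1 <= T%:R :> R by rewrite ler1n.
have Lpos : 0 < linfnorm L.
  by rewrite (lt_le_trans (L0 (Ordinal d0)))// (le_trans (ler_norm _))// coord_le_linfnorm.
pose s := lpnorm p sigma.
have s0 : 0 <= s by exact: powR_ge0.
have sE : s `^ p = \sum_i sigma 0 i `^ p by exact: lpnorm_powR.
set q := Num.sqrt T%:R.
have q0 : 0 < q by rewrite sqrtr_gt0.
have qq : q * q = T%:R by rewrite -expr2 sqr_sqrtr// ltW.
pose n1 := l2norm (gradient f x1); have n10 : 0 <= n1 := l2norm_ge0 _.
pose m0 := s * T%:R `^ p^-1.
have m00 : 0 <= m0 by rewrite mulr_ge0// powR_ge0.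
pose G := gamma * linfnorm L; have G0 : 0 < G by rewrite mulr_gt0.
have KE : lambda * (K - 1) = Num.sqrt 2 * m0 + 2 * (n1 * q) + 2 * (G * (T%:R * q)).
  have -> : T%:R * q = T%:R `^ (3 / 2).
    have -> : 3 / 2 = 1 + 2^-1 :> R by field.
    by rewrite powRD ?(gt_eqF t0) ?implybT// powRr1 ?(ltW t0)// powR12_sqrt// ltW.
  have -> : q = T%:R `^ 2^-1 by rewrite powR12_sqrt// ltW.
  rewrite /K /m0 /G /n1 /s [1 + _]addrC addrK mulrC divfK ?gt_eqF//; ring.
have sqrt2 : 1 <= Num.sqrt 2 :> R by rewrite -[leLHS]sqrtr1 ler_sqrt// ler1n.
have Gt0 : 0 < G * (T%:R * q) by rewrite !mulr_gt0.
have K1 : 1 < K.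
  rewrite -subr_gt0 -(pmulr_rgt0 _ lambda0) KE.
  by rewrite ltr_wpDl ?mulr_gt0// addr_ge0 ?mulr_ge0 ?sqrtr_ge0 ?(ltW q0).
have K0 : 0 < K by rewrite (lt_trans ltr01).
have l0 : 0 < ln K by rewrite ln_gt0.
have D0 : 0 <= Delta by rewrite subr_ge0; apply: ge_inf => //; exists x1.
pose A := Delta / gamma + G * ln K.
have A0 : 0 < A by rewrite ltr_wpDl ?mulr_gt0// divr_ge0// ltW.
have iN t : t \in index_iota 1 T.+1 -> P.-integrable setT (EFin \o grad_norm f x t).
  rewrite mem_index_iota => /andP[u1 _].
  exact: (integrable_grad_norm smooth gamma0 lambda0 g_measurable adagrad unbiased u1).
have iS := integrable_real_sum iN.
rewrite expectation_Rintegral; last exact: (integrable_real_Z T%:R^-1 iS).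
rewrite lee_fin (RintegralZl _ measurableT iS).
set I := \int[P]_w _.
set B1 := _ / q; set B2 := _ / _ `^ ((p - 1) / p); set B3 := _ / _ `^ ((p - 1) / (2 * p)).
set B4 := _ / _.
have B1E : B1 = (lambda + A) / q by rewrite /B1 /A /G; congr (_ / _); ring.
have B10 : 0 <= B1 by rewrite B1E divr_ge0 ?(ltW q0)//; exact: addr_ge0 (ltW lambda0) (ltW A0).
have B20 : 0 <= B2 by rewrite divr_ge0 ?mulr_ge0 ?powR_ge0.
have B30 : 0 <= B3 by rewrite divr_ge0 ?sqrtr_ge0 ?powR_ge0.
have B40 : 0 <= B4 by rewrite divr_ge0 ?mulr_ge0 ?powR_ge0.
have lB1 : lambda / q <= B1.
  by rewrite B1E ler_pM2r ?invr_gt0// lerDl ltW.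
have m0s2 : m0 <= Num.sqrt 2 * m0 by rewrite ler_peMl.
(* If K <= 4, then every term of lambda (K - 1) is at most 3 lambda and the
   pathwise growth bound on the gradients suffices; otherwise ln K >= 1. *)
have [K4|K4] := leP K 4.
  set gb := grad_bound f L gamma x1 T.
  have Igb : I <= T%:R * gb.
    rewrite -[leRHS](Rintegral_probability_cst P).
    apply: le_Rintegral => //; first exact: integrable_real_cst.
    move=> w _; have -> : T%:R * gb = \sum_(1 <= t < T.+1) gb.
      by rewrite sumr_const_nat subSS subn0 mulr_natl.
    rewrite big_seq [leRHS]big_seq; apply: ler_sum => t; rewrite mem_index_iota => tT.
    exact: (grad_norm_le smooth gamma0 lambda0 adagrad).
  have lK : lambda * (K - 1) <= lambda * 3 by rewrite ler_pM2l// lerBlDr; lra.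
  have gbl : gb <= 5 * (lambda / q).
    rewrite mulrA ler_pdivlMr//.
    have -> : gb * q = n1 * q + 3 * (G * (T%:R * q)) by rewrite /gb /grad_bound /n1 /G; ring.
    have nq0 : 0 <= n1 * q by rewrite mulr_ge0// ltW.
    by move: m00 m0s2 lK KE nq0 Gt0 lambda0; lra.
  have : T%:R^-1 * I <= gb by rewrite mulrC ler_pdivrMr// mulrC.
  by move: gbl lB1 B10 B20 B30 B40; lra.
have l1 : 1 <= ln K by exact: ln_ge1 (ltW K4).
have Tq : T%:R^-1 * q = q^-1 by rewrite -qq invfM -mulrA mulVf ?mulr1// gt_eqF.
have nq0 : 0 <= n1 * q by rewrite mulr_ge0// ltW.
have main s' N m : N = effective_noise T%:R (ln K) s' p * ln K -> m = s' * T%:R `^ p^-1 ->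
    0 < s' -> \sum_i sigma 0 i `^ p <= s' `^ p ->
    m + n1 * q + G * (T%:R * q) <= lambda * (K - 1) ->
    T%:R^-1 * I <= 600 * ((lambda + A) / q + N / q + Num.sqrt (A * m) / q + Num.sqrt (N * m) / q).
  move=> NE mE s'0 ssp budget.
  have h := expected_sum_le f_lb Lpos smooth p12 gamma0 lambda0 g_measurable adagrad
    unbiased heavy_tail T0 NE mE K0 l1 s'0 ssp budget.
  have iT0 : 0 <= T%:R^-1 :> R by rewrite invr_ge0 ltW.
  apply: le_trans (ler_wpM2l iT0 h) _.
  by rewrite -/q -/Delta -/G -/A mulrA Tq -!mulrDl mulrCA [q^-1 * _]mulrC.
(* The truncation needs a positive noise level.  For sigma = 0 a level s' is
   chosen so small that its contributions are at most lambda; the factor 2 in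
   front of the smoothness term of K leaves room for it. *)
have [s_gt0|s_le0] := ltP 0 s.
  have := main s _ m0 erefl erefl s_gt0; rewrite sE lexx => /(_ isT).
  have budget : m0 + n1 * q + G * (T%:R * q) <= lambda * (K - 1).
    by rewrite KE; move: nq0 Gt0 m0s2; lra.
  move=> /(_ budget).
  rewrite rate_noise// rate_tail// rate_cross ?(ltW A0)// -B1E.
  rewrite -/B2 -/B3 -/B4.
  by move: B10 B20 B30 B40; lra.
have sz : s = 0 by apply/eqP; rewrite eq_le s_le0 s0.
pose nu := effective_noise T%:R (ln K) 1 p * ln K.
pose mu := T%:R `^ p^-1 : R.
have nu0 : 0 <= nu by rewrite mulr_ge0 ?(ltW l0)// ltW// effective_noise_gt0.
have mu0 : 0 <= mu by exact: powR_ge0.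
pose e := Num.min lambda (G * (T%:R * q)).
have e0 : 0 < e by rewrite lt_min lambda0.
pose s' := e / (1 + nu + mu).
have den0 : 0 < 1 + nu + mu by rewrite -addrA ltr_pwDl// addr_ge0.
have s'0 : 0 < s' by rewrite divr_gt0.
have NE : s' * nu = effective_noise T%:R (ln K) s' p * ln K.
  by rewrite /nu /effective_noise /truncation_level mul1r; ring.
have Ne : s' * nu <= e.
  by rewrite /s' mulrAC ler_pdivrMr// ler_pM2l//; lra.
have me : s' * mu <= e.
  by rewrite /s' mulrAC ler_pdivrMr// ler_pM2l//; lra.
have el : e <= lambda by rewrite ge_min lexx.
have eG : e <= G * (T%:R * q) by rewrite ge_min lexx orbT.
have ssp : \sum_i sigma 0 i `^ p <= s' `^ p.
  by rewrite -sE sz powR0 ?powR_ge0// gt_eqF// (lt_trans ltr01).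
have budget : s' * mu + n1 * q + G * (T%:R * q) <= lambda * (K - 1).
  by rewrite KE; move: nq0 Gt0 m0s2 m00 me eG; lra.
have := main s' _ _ NE erefl s'0 ssp budget.
have N0 : 0 <= s' * nu by rewrite mulr_ge0// ltW.
have M0 : 0 <= s' * mu by rewrite mulr_ge0// ltW.
have lA : 0 <= lambda + A by apply: addr_ge0; exact: ltW.
have sA : Num.sqrt (A * (s' * mu)) <= lambda + A.
  rewrite -[leRHS]ger0_norm// -sqrtr_sqr ler_sqrt ?sqr_ge0//.
  have As : A * (s' * mu) <= A * lambda by rewrite ler_pM2l// (le_trans me).
  have : 0 < A * lambda by rewrite mulr_gt0.
  by have := sqr_ge0 lambda; have := sqr_ge0 A; move: As; lra.
have sN : Num.sqrt (s' * nu * (s' * mu)) <= lambda.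
  rewrite -[leRHS](gtr0_norm lambda0) -sqrtr_sqr ler_sqrt ?sqr_ge0// expr2.
  by rewrite ler_pM// (le_trans _ el).
rewrite -!mulrDl => /le_trans; apply.
have : (lambda + A + s' * nu + Num.sqrt (A * (s' * mu)) + Num.sqrt (s' * nu * (s' * mu))) / q
   <= 4 * B1.
  rewrite B1E [leRHS]mulrA ler_pM2r ?invr_gt0//.
  by move: Ne el sA sN (ltW A0); lra.
by move: B20 B30 B40; lra.
Qed.
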